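(* Let $\mathcal{B}$ be a unital $C^*$-algebra of real rank zero, $\mathcal{M}$ a unital $C^*$-algebra, and $\pi:\mathcal{B}\to\mathcal{M}$ a unital surjective $\ast$-homomorphism. Let $\{p_1,p_2,\ldots\}\subseteq\mathcal{M}$ be a (countable) commuting family of projections. Then there is a unital $\ast$-cross section $\gamma$ for $\pi$ on $C^*(p_1,p_2,\ldots)$. Moreover, if $\gamma_n: C^*(p_1,\ldots,p_n)\to\mathcal{B}$ is a unital $\ast$-cross section for $\pi$ on $C^*(p_1,\ldots,p_n)$, then there is a unital $\ast$-cross section $\gamma_{n+1}$ for $\pi$ on $C^*(p_1,\ldots,p_{n+1})$ whose restriction to $C^*(p_1,\ldots,p_n)$ is $\gamma_n$.
   Context: A $C^*$-algebra has real rank zero if every self-adjoint element is a norm limit of self-adjoint elements with finite spectrum. For a surjective $\ast$-homomorphism $\pi:\mathcal{B}\to\mathcal{M}$ and a $C^*$-subalgebra $\mathcal{S}\subseteq\mathcal{M}$, a $\ast$-cross section for $\pi$ on $\mathcal{S}$ is a $\ast$-homomorphism $\gamma:\mathcal{S}\to\mathcal{B}$ such that $\pi\circ\gamma$ is the identity on $\mathcal{S}$; it is unital if $\gamma(1)=1$. *)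

(* Defs.v *)
(* unital C*-algebras over the complex numbers R[i]
   (R : realType, so R is the real numbers up to isomorphism),
   set up from scratch as bundled records. *)
From HB Require Import structures.
From mathcomp Require Import all_boot all_order all_algebra.
From mathcomp Require Import reals.
From mathcomp.real_closed Require Import complex.
Set Implicit Arguments. Unset Strict Implicit. Unset Printing Implicit Defensive.
Import Order.TTheory GRing.Theory Num.Theory.
Local Open Scope ring_scope.

Section CStarDefs.
Variable R : realType.
Local Notation C := (R[i]).

(* modulus of a complex number, as a real number *)
Definition cmod (c : C) : R := complex.Re `|c|.

(* axioms of a unital C*-algebra: a complete normed complex *-algebra
   satisfying the C*-identity *)
Record cstar_axioms (A : algType C) (star : A -> A) (nrm : A -> R) : Prop := {
  nrm_eq0 : forall a, nrm a = 0 <-> a = 0;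
  nrm_ge0 : forall a, 0 <= nrm a;
  nrmD : forall a b, nrm (a + b) <= nrm a + nrm b;
  nrmZ : forall (c : C) a, nrm (c *: a) = cmod c * nrm a;
  nrmM : forall a b, nrm (a * b) <= nrm a * nrm b;
  nrm_complete : forall u : nat -> A,
    (forall e : R, 0 < e -> exists N, forall m n, (N <= m)%N -> (N <= n)%N ->
        nrm (u m - u n) < e) ->
    exists l : A, forall e : R, 0 < e -> exists N, forall n, (N <= n)%N ->
        nrm (u n - l) < e;
  starD : forall a b, star (a + b) = star a + star b;
  starZ : forall (c : C) a, star (c *: a) = (c^*)%C *: star a;
  starM : forall a b, star (a * b) = star b * star a;
  starK : forall a, star (star a) = a;
  cstar_id : forall a, nrm (star a * a) = nrm a ^+ 2
}.

Record cstarAlgebra := CStarAlgebra {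
  cs_car :> algType C;
  cs_star : cs_car -> cs_car;
  cs_norm : cs_car -> R;
  cs_ax : cstar_axioms cs_star cs_norm
}.

Section InAlgebra.
Variable A : cstarAlgebra.

Definition selfadjoint (a : A) : Prop := cs_star a = a.
Definition projection (p : A) : Prop := cs_star p = p /\ p * p = p.

Definition invertible (a : A) : Prop := exists b : A, a * b = 1 /\ b * a = 1.

(* spectrum: lambda such that a - lambda 1 is not invertible *)
Definition spectrum (a : A) (l : C) : Prop := ~ invertible (a - l%:A).

Definition finite_spectrum (a : A) : Prop :=
  exists s : seq C, forall l, spectrum a l -> l \in s.

Definition real_rank_zero : Prop :=
  forall a : A, selfadjoint a -> forall e : R, 0 < e ->
    exists b : A, selfadjoint b /\ finite_spectrum b /\ cs_norm (a - b) < e.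

(* norm-closed sets *)
Definition norm_closed (S : A -> Prop) : Prop :=
  forall (u : nat -> A) (l : A), (forall n, S (u n)) ->
    (forall e : R, 0 < e -> exists N, forall n, (N <= n)%N -> cs_norm (u n - l) < e) ->
    S l.

(* unital C*-subalgebras: closed unital *-subalgebras *)
Definition unital_cstar_subalgebra (S : A -> Prop) : Prop :=
  [/\ S 1,
      forall (c : C) a b, S a -> S b -> S (c *: a + b),
      forall a b, S a -> S b -> S (a * b),
      forall a, S a -> S (cs_star a)
    & norm_closed S].

(* C*(G): the (unital) C*-subalgebra generated by G, i.e. the smallest one *)
Definition cstar_gen (G : A -> Prop) : A -> Prop :=
  fun x => forall S : A -> Prop, unital_cstar_subalgebra S ->
             (forall g, G g -> S g) -> S x.

End InAlgebra.

(* unital *-homomorphisms *)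
Definition unital_star_hom (A B : cstarAlgebra) (f : A -> B) : Prop :=
  [/\ forall (c : C) a b, f (c *: a + b) = c *: f a + f b,
      forall a b, f (a * b) = f a * f b,
      forall a, f (cs_star a) = cs_star (f a)
    & f 1 = 1].

(* a unital *-cross section for pi on the C*-subalgebra S of M,
   represented by a function M -> B whose values outside S are irrelevant *)
Definition unital_cross_section (B M : cstarAlgebra) (pi : B -> M)
    (S : M -> Prop) (g : M -> B) : Prop :=
  [/\ forall (c : C) a b, S a -> S b -> g (c *: a + b) = c *: g a + g b,
      forall a b, S a -> S b -> g (a * b) = g a * g b,
      forall a, S a -> g (cs_star a) = cs_star (g a),
      forall a, S a -> pi (g a) = a
    & g 1 = 1].

End CStarDefs.

(* Main.v *)
(* C*(p_1, ..., p_n) is the span of finitely many orthogonal projections q_j with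
   sum 1. To extend a cross section to p = p_(n+1), p is lifted to a projection P of
   B commuting with the lifts Q_j of the q_j, and q_j p is sent to Q_j P, except that
   it is sent to 0 or to Q_j when it is 0 or q_j. The infinite case follows by
   iteration, since *-homomorphisms are contractive and hence extend to closures.

   For the lift P: in real rank zero the invertible self-adjoint elements are dense
   among the self-adjoint ones, and by Schur complements this remains true in the
   commutant of the Q_j. Hence a self-adjoint lift a of the symmetry s = 2p - 1
   commuting with the Q_j is close to an invertible self-adjoint b; the conjugate of b
   by a suitable invertible element near 1 lifts s exactly, and its sign is a symmetry
   lifting s. The only functional calculus needed is the square root of 1 - x for
   |x| <= 1: it gives the sign, and contractivity too, since a self-adjoint h with
   |h| <= 1 is the real part of the unitary h + i (1 - h^2)^(1/2). *)
Require Import Defs.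
From HB Require Import structures.
From mathcomp Require Import all_boot all_order all_algebra.
From mathcomp Require Import reals boolp.
From mathcomp Require Import ring lra.
From mathcomp.real_closed Require Import complex.
Import Order.TTheory GRing.Theory Num.Theory.
Local Open Scope ring_scope.

Set Implicit Arguments. Unset Strict Implicit. Unset Printing Implicit Defensive.

(** * Limits and square roots *)

Section CStarBasics.
Variables (R : realType) (A : cstarAlgebra R).
Implicit Types (a b x y z l : A) (r e : R) (u v : nat -> A).

Lemma cmod_real r : cmod (r%:C)%C = `|r|.
Proof. by rewrite /cmod normc_def /= expr0n addr0 sqrtr_sqr. Qed.

Lemma cs_norm_ge0 a : 0 <= cs_norm a. Proof. exact: (nrm_ge0 (cs_ax A)). Qed.

Lemma cs_normD a b : cs_norm (a + b) <= cs_norm a + cs_norm b.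
Proof. exact: (nrmD (cs_ax A)). Qed.

Lemma cs_normM a b : cs_norm (a * b) <= cs_norm a * cs_norm b.
Proof. exact: (nrmM (cs_ax A)). Qed.

Lemma cs_halfK a : ((2^-1 : R)%:C)%C *: (a + a) = a.
Proof.
rewrite scalerDr -scalerDl -rmorphD /= (_ : 2^-1 + 2^-1 = 1 :> R) ?scale1r //; lra.
Qed.

Lemma cs_norm0 : cs_norm (0 : A) = 0.
Proof. exact/(nrm_eq0 (cs_ax A)). Qed.

Lemma cs_norm_eq0 a : cs_norm a = 0 -> a = 0.
Proof. by move/(nrm_eq0 (cs_ax A)). Qed.

Lemma cs_normZ r a : cs_norm ((r%:C)%C *: a) = `|r| * cs_norm a.
Proof. by rewrite (nrmZ (cs_ax A)) cmod_real. Qed.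

Lemma cs_normN a : cs_norm (- a) = cs_norm a.
Proof.
have -> : - a = ((-1 : R)%:C)%C *: a by rewrite rmorphN1 scaleN1r.
by rewrite cs_normZ normrN1 mul1r.
Qed.

Lemma cs_distC a b : cs_norm (a - b) = cs_norm (b - a).
Proof. by rewrite -cs_normN opprB. Qed.

Lemma cs_starD a b : cs_star (a + b) = cs_star a + cs_star b.
Proof. exact: (starD (cs_ax A)). Qed.

Lemma cs_starZ c a : cs_star (c *: a) = (c^*)%C *: cs_star a.
Proof. exact: (starZ (cs_ax A)). Qed.

Lemma cs_starZr r a : cs_star ((r%:C)%C *: a) = (r%:C)%C *: cs_star a.
Proof. by rewrite cs_starZ conjc_real. Qed.

Lemma cs_starM a b : cs_star (a * b) = cs_star b * cs_star a.
Proof. exact: (starM (cs_ax A)). Qed.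

Lemma cs_starK a : cs_star (cs_star a) = a.
Proof. exact: (starK (cs_ax A)). Qed.

Lemma cs_star0 : cs_star (0 : A) = 0.
Proof. by apply: (addIr (cs_star 0)); rewrite -cs_starD !add0r. Qed.

Lemma cs_starN a : cs_star (- a) = - cs_star a.
Proof. by apply: (addIr (cs_star a)); rewrite -cs_starD !addNr cs_star0. Qed.

Lemma cs_starB a b : cs_star (a - b) = cs_star a - cs_star b.
Proof. by rewrite cs_starD cs_starN. Qed.

Lemma cs_star1 : cs_star (1 : A) = 1.
Proof. by have := cs_starM (cs_star 1) 1; rewrite mulr1 cs_starK mulr1. Qed.

Lemma cs_star_sum (I : Type) (s : seq I) (P : pred I) (F : I -> A) :
  cs_star (\sum_(i <- s | P i) F i) = \sum_(i <- s | P i) cs_star (F i).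
Proof. exact: (big_morph _ cs_starD cs_star0). Qed.

Lemma cs_normC a : cs_norm (cs_star a * a) = cs_norm a ^+ 2.
Proof. exact: (cstar_id (cs_ax A)). Qed.

(** The C*-identity and submultiplicativity bound the square of the norm of [b] by
    [cs_norm (cs_star b) * cs_norm b]. Cancelling one factor gives one inequality, and applying it
    to [cs_star b] gives the other. *)
Lemma cs_norm_star a : cs_norm (cs_star a) = cs_norm a.
Proof.
have le b : cs_norm b <= cs_norm (cs_star b).
  have := cs_normM (cs_star b) b; rewrite cs_normC expr2.
  have [->|nz] := eqVneq (cs_norm b) 0; first by rewrite cs_norm_ge0.
  by rewrite ler_pM2r // lt0r nz cs_norm_ge0.
by apply/eqP; rewrite eq_le le andbT -{2}(cs_starK a) le.
Qed.

Lemma cs_norm_sa a : cs_star a = a -> cs_norm (a * a) = cs_norm a ^+ 2.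
Proof. by move=> sa; rewrite -cs_normC sa. Qed.

Lemma cs_norm_proj_le1 a : projection a -> cs_norm a <= 1.
Proof.
move=> [sa ida]; have := cs_norm_sa sa; rewrite ida => e {sa ida}.
by rewrite leNgt; apply/negP => a1; nra.
Qed.

Lemma projection1 : projection (1 : A).
Proof. by split; rewrite ?cs_star1 ?mulr1. Qed.

Lemma cs_norm1 : cs_norm (1 : A) <= 1.
Proof. exact: cs_norm_proj_le1 projection1. Qed.

Definition tends u l := forall e, 0 < e ->
  exists N, forall n, (N <= n)%N -> cs_norm (u n - l) < e.

Lemma tends_cst l : tends (fun=> l) l.
Proof. by move=> e e0; exists 0%N => n _; rewrite subrr cs_norm0. Qed.

Lemma tends_shift u l : tends u l -> tends (fun n => u n.+1) l.
Proof. by move=> ul e /ul[N H]; exists N => n Nn; apply/H/leqW. Qed.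

Lemma tends_unique u l l' : tends u l -> tends u l' -> l = l'.
Proof.
move=> ul ul'; apply/eqP; rewrite -subr_eq0; apply/eqP/cs_norm_eq0/eqP.
rewrite eq_le cs_norm_ge0 andbT; apply/ler_addgt0Pr => e e0; rewrite add0r.
have e2 : 0 < e / 2 by lra.
have [N1 H1] := ul _ e2; have [N2 H2] := ul' _ e2.
have {}H1 := H1 _ (leq_maxl N1 N2); have {}H2 := H2 _ (leq_maxr N1 N2).
have -> : l - l' = (u (maxn N1 N2) - l') - (u (maxn N1 N2) - l).
  by rewrite opprB [RHS]addrC addrA subrK.
by have := cs_normD (u (maxn N1 N2) - l') (- (u (maxn N1 N2) - l)); rewrite cs_normN; lra.
Qed.

Lemma tendsD u v l l' : tends u l -> tends v l' -> tends (fun n => u n + v n) (l + l').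
Proof.
move=> ul vl e e0; have e2 : 0 < e / 2 by lra.
have [N1 H1] := ul _ e2; have [N2 H2] := vl _ e2.
exists (maxn N1 N2) => n; rewrite geq_max => /andP[/H1 h1 /H2 h2].
rewrite opprD addrACA; have := cs_normD (u n - l) (v n - l'); lra.
Qed.

Lemma tendsM u v l l' : tends u l -> tends v l' -> tends (fun n => u n * v n) (l * l').
Proof.
move=> ul vl e e0.
have L0 := cs_norm_ge0 l; have L1 := cs_norm_ge0 l'.
(* For [d <= 1] the three error terms below add up to at most [d * (1 + cs_norm l + cs_norm l')];
   the constant 2 instead of 1 makes the final inequality strict. *)
set s := 2 + cs_norm l + cs_norm l'; have s0 : 0 < s by rewrite /s; lra.
pose d := Num.min 1 (e / s).
have d0 : 0 < d by rewrite lt_min ltr01 divr_gt0.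
have d1 : d <= 1 by rewrite ge_min lexx.
have ds : d * s <= e by rewrite -ler_pdivlMr // ge_min lexx orbT.
have [N1 H1] := ul _ d0; have [N2 H2] := vl _ d0.
exists (maxn N1 N2) => n; rewrite geq_max => /andP[/H1 h1 /H2 h2].
have -> : u n * v n - l * l' = (u n - l) * (v n - l') + (u n - l) * l' + l * (v n - l').
  by rewrite -mulrDr subrK mulrBl mulrBr addrA subrK.
apply: le_lt_trans (cs_normD _ _) _.
have := cs_normD ((u n - l) * (v n - l')) ((u n - l) * l').
have := cs_normM (u n - l) (v n - l'); have := cs_normM (u n - l) l'.
have := cs_normM l (v n - l').
have a0 := cs_norm_ge0 (u n - l); have b0 := cs_norm_ge0 (v n - l').
have : cs_norm (u n - l) * cs_norm (v n - l') <= d * 1.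
  by apply: ler_pM (ltW h1) _ => //; apply: le_trans (ltW h2) d1.
have : cs_norm (u n - l) * cs_norm l' <= d * cs_norm l'.
  exact: ler_wpM2r (ltW h1).
have : cs_norm l * cs_norm (v n - l') <= cs_norm l * d.
  exact: ler_wpM2l (ltW h2).
by move: ds; rewrite /s; lra.
Qed.

Lemma tendsZ c u l : tends u l -> tends (fun n => c *: u n) (c *: l).
Proof.
move=> /(tendsM (tends_cst (c%:A))) H e /H[N HN]; exists N => n /HN.
by rewrite -!scalerAl !mul1r.
Qed.

Lemma tends_star u l : tends u l -> tends (fun n => cs_star (u n)) (cs_star l).
Proof. by move=> ul e /ul[N H]; exists N => n /H; rewrite -cs_starB cs_norm_star. Qed.

Lemma tends_norm_le u l r : tends u l -> (forall n, cs_norm (u n) <= r) -> cs_norm l <= r.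
Proof.
move=> ul ur; apply/ler_addgt0Pr => e /ul[N /(_ _ (leqnn _)) H].
rewrite -[l](subrK (u N)); apply: le_trans (cs_normD _ _) _.
by rewrite cs_distC; have := ur N; lra.
Qed.

Lemma tends_intertwine u v l l' z z' : tends u l -> tends v l' ->
  (forall n, z * u n = v n * z') -> z * l = l' * z'.
Proof.
move=> ul vl H; apply: tends_unique (tendsM (tends_cst z) ul) _ => e e0.
by have [N HN] := tendsM vl (tends_cst z') e0; exists N => n /HN; rewrite H.
Qed.

(** Majorant method: [eta] is nondecreasing because its increments bound norms, and it is bounded.
    Beyond an index where [eta] is close to its supremum, telescoping keeps [u] within a small ball,
    so [u] is Cauchy. *)
Lemma tends_dominated u (eta : nat -> R) r :
  (forall n, cs_norm (u n.+1 - u n) <= eta n.+1 - eta n) ->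
  (forall n, eta n <= r) -> exists l, tends u l.
Proof.
move=> H etar.
have tele m k : cs_norm (u (m + k)%N - u m) <= eta (m + k)%N - eta m.
  elim: k => [|k IH]; first by rewrite addn0 !subrr cs_norm0.
  rewrite addnS.
  have -> : u (m + k).+1 - u m = (u (m + k).+1 - u (m + k)%N) + (u (m + k)%N - u m).
    by rewrite addrA subrK.
  apply: le_trans (cs_normD _ _) _; have := H (m + k)%N; lra.
pose E : classical_sets.set R := fun t => exists n, t = eta n.
have supE : classical_sets.has_sup E.
  by split; [exists (eta 0%N), 0%N | exists r => _ [n ->]].
apply: (nrm_complete (cs_ax A)) => e e0; have e2 : 0 < e / 2 by lra.
have [_ [N ->] HN] := sup_adherent e2 supE; exists N.
have near n : (N <= n)%N -> cs_norm (u n - u N) < e / 2.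
  move=> /subnKC <-; apply: le_lt_trans (tele _ _) _.
  suff : eta (N + (n - N))%N <= sup E by lra.
  by apply: ub_le_sup; [case: supE | exists (N + (n - N))%N].
move=> m n /near hm /near hn; rewrite -[u m](subrK (u N)) -addrA.
apply: le_lt_trans (cs_normD _ _) _; rewrite (cs_distC (u N)); lra.
Qed.

(** Geometric series: the increments of [u] are the powers of [x], and the scalar geometric sums
    serve as majorant. The limit satisfies [g = 1 + x * g] and commutes with [x], which gives the
    inverse on both sides. *)
Lemma neumann x : cs_norm x < 1 -> exists g, g * (1 - x) = 1 /\ (1 - x) * g = 1.
Proof.
move=> x1; have x0 := cs_norm_ge0 x.
pose u := fix u n : A := if n is m.+1 then 1 + x * u m else 0.
have comm n : x * u n = u n * x.
  by elim: n => [|n IH] /=; rewrite ?mulr0 ?mul0r // mulrDr mulr1 {1}IH mulrDl mul1r mulrA.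
have [g ug] : exists g, tends u g.
  pose eta n := (1 - cs_norm x ^+ n) / (1 - cs_norm x).
  apply: (@tends_dominated _ eta (1 - cs_norm x)^-1) => n.
    have -> : eta n.+1 - eta n = cs_norm x ^+ n.
      by rewrite /eta exprS; field; lra.
    elim: n => [|n IH]; first by rewrite /= mulr0 addr0 subr0 expr0 cs_norm1.
    have -> : u n.+2 - u n.+1 = x * (u n.+1 - u n).
      by rewrite mulrBr [u n.+2]/= [X in _ - X]/= opprD addrACA subrr add0r.
    by apply: le_trans (cs_normM _ _) _; rewrite exprS; apply: ler_wpM2l.
  rewrite /eta ler_pdivrMr; last lra.
  by rewrite mulVf; [have := exprn_ge0 n x0; lra | lra].
have eg : g = 1 + x * g.
  exact: tends_unique (tends_shift ug) (tendsD (tends_cst 1) (tendsM (tends_cst x) ug)).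
have cg : x * g = g * x := tends_intertwine ug ug comm.
by exists g; rewrite mulrBl mulrBr mulr1 mul1r -cg {1 3}eg addrK.
Qed.

(* Visser's iteration for [1 - (1 - x)^(1/2)]. Comparison with the scalar case
   [x = 1] gives convergence on the whole closed unit ball. *)
Fixpoint visser x n : A :=
  if n is m.+1 then ((2^-1 : R)%:C)%C *: (x + visser x m * visser x m) else 0.

Lemma visser_comm x n : x * visser x n = visser x n * x.
Proof.
elim: n => [|n IH] /=; first by rewrite mulr0 mul0r.
by rewrite -scalerAl -scalerAr mulrDl mulrDr mulrA IH -!mulrA IH.
Qed.

Lemma visser_commS x n m : visser x n * visser x m = visser x m * visser x n.
Proof.
elim: n => [|n IH] /=; first by rewrite mulr0 mul0r.
by rewrite -scalerAl -scalerAr mulrDl mulrDr visser_comm -mulrA IH mulrA IH mulrA.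
Qed.

Lemma visser_cvg x : cs_norm x <= 1 ->
  exists2 y, tends (visser x) y & cs_norm y <= 1.
Proof.
move=> x1.
pose eta := fix eta n : R := if n is m.+1 then (1 + eta m ^+ 2) / 2 else 0.
have etaS n : eta n.+1 = (1 + eta n ^+ 2) / 2 by [].
have eta01 n : 0 <= eta n <= 1 by elim: n => [|n] /=; [lra|nra].
have nv n : cs_norm (visser x n) <= eta n.
  elim: n => [|n IH] /=; first by rewrite cs_norm0.
  rewrite cs_normZ ger0_norm; last lra.
  have := cs_normD x (visser x n * visser x n); have := cs_normM (visser x n) (visser x n).
  have := cs_norm_ge0 (visser x n); nra.
have [||y vy] := @tends_dominated (visser x) eta 1; last 1 first.
- by exists y => //; apply: tends_norm_le vy _ => n; have := nv n; have := eta01 n; lra.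
- elim=> [|n IH].
    rewrite /= mulr0 addr0 !subr0 expr0n addr0 cs_normZ ger0_norm; lra.
  (* A difference of squares factors because the iterates commute. The increments of [eta] obey the
     same recursion, so domination passes from one step to the next. *)
  have -> : visser x n.+2 - visser x n.+1 =
      ((2^-1 : R)%:C)%C *: ((visser x n.+1 - visser x n) * (visser x n.+1 + visser x n)).
    rewrite mulrBl !mulrDr (visser_commS x n n.+1) opprD addrA addrK.
    by rewrite [in LHS]/= -scalerBr opprD addrACA subrr add0r.
  have -> : eta n.+2 - eta n.+1 = 2^-1 * ((eta n.+1 - eta n) * (eta n.+1 + eta n)).
    by rewrite (etaS n.+1) {2}(etaS n); field.
  rewrite cs_normZ ger0_norm ?ler_wpM2l //; try lra.
  apply: le_trans (cs_normM _ _) _; apply: ler_pM; rewrite ?cs_norm_ge0 //.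
  by apply: le_trans (cs_normD _ _) _; apply: lerD.
- by move=> n; have := eta01 n; lra.
Qed.

(** The limit is a fixed point of the iteration, [y + y = x + y * y], and completing the square
    gives the claim. *)
Lemma visser_sqr x y : tends (visser x) y -> (1 - y) * (1 - y) = 1 - x.
Proof.
move=> vy.
have e : y = ((2^-1 : R)%:C)%C *: (x + y * y).
  exact: tends_unique (tends_shift vy) (tendsZ _ (tendsD (tends_cst x) (tendsM vy vy))).
have : y + y = x + y * y.
  by rewrite {1 2}e -scalerDr cs_halfK.
move=> e2; have -> : x = y + y - y * y by rewrite e2 addrK.
by rewrite mulrBl !mulrBr !mulr1 mul1r !opprB opprD !addrA (addrAC 1 (- y)).
Qed.

(** The relation passes to every iterate and then to the limit. With [x' = x] it says that the
    square root commutes with all that commutes with [x]; with [x'] the adjoint of [x] it relates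
    the square root to its adjoint. *)
Lemma visser_intertwine x x' y y' z : tends (visser x) y -> tends (visser x') y' ->
  z * x = x' * z -> z * y = y' * z.
Proof.
move=> vy vy' H; apply: tends_intertwine vy vy' _.
elim=> [|n IH] /=; first by rewrite mulr0 mul0r.
by rewrite -scalerAr -scalerAl mulrDl mulrDr H mulrA IH -!mulrA IH.
Qed.

Lemma visser_star x n : cs_star (visser x n) = visser (cs_star x) n.
Proof. by elim: n => [|n IH] /=; rewrite ?cs_star0 // cs_starZr cs_starD cs_starM IH. Qed.

Lemma tends_visser_star x y :
  tends (visser x) y -> tends (visser (cs_star x)) (cs_star y).
Proof. by move/tends_star => H e /H[N HN]; exists N => n /HN; rewrite visser_star. Qed.

End CStarBasics.

(** * Contractivity of star-homomorphisms *)

Section Contraction.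
Variables (R : realType) (A : cstarAlgebra R).
Implicit Types (a b x y z h k : A) (r : R).

Lemma commuteB1 z y : z * y = y * z -> z * (1 - y) = (1 - y) * z.
Proof. by move=> zy; rewrite mulrBr mulrBl mulr1 mul1r zy. Qed.

Lemma inverse_comm x g z : x * g = 1 -> g * x = 1 -> z * x = x * z -> z * g = g * z.
Proof.
move=> xg gx zx; rewrite -[LHS]mul1r -gx -mulrA [X in g * X]mulrA -zx.
by rewrite -!mulrA xg mulr1.
Qed.

Lemma inverse_sa x g : x * g = 1 -> g * x = 1 -> cs_star x = x -> cs_star g = g.
Proof.
move=> xg gx sx; rewrite -[LHS]mulr1 -xg mulrA -{1}sx -cs_starM xg.
by rewrite cs_star1 mul1r.
Qed.

(* [h + i k] is unitary and [h] is its real part. *)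
Lemma norm_le1_sqrD h k : cs_star h = h -> cs_star k = k -> h * k = k * h ->
  h * h + k * k = 1 -> cs_norm h <= 1.
Proof.
move=> sh sk hk e; pose u := h + 'i%C *: k.
have su : cs_star u = h - 'i%C *: k.
  rewrite /u cs_starD sh cs_starZ sk -scaleNr; congr (_ + _ *: _).
  by apply/eqP; rewrite eq_complex /= oppr0 !eqxx.
have uu : cs_star u * u = 1.
  rewrite su mulrBl !mulrDr -!scalerAl -!scalerAr scalerA hk opprD addrA addrK.
  by rewrite -(expr2 'i%C) sqr_i scaleN1r opprK.
have u1 : cs_norm u <= 1.
  by rewrite -(@expr_le1 _ 2) ?cs_norm_ge0 // -cs_normC uu cs_norm1.
have -> : h = ((2^-1 : R)%:C)%C *: (u + cs_star u).
  by rewrite su /u addrACA subrr addr0 cs_halfK.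
rewrite cs_normZ ger0_norm; last lra.
by have := cs_normD u (cs_star u); rewrite cs_norm_star; lra.
Qed.

Lemma visser_sa x y : cs_star x = x -> tends (visser x) y -> cs_star y = y.
Proof.
by move=> sx vy; have := tends_visser_star vy; rewrite sx => /tends_unique; apply.
Qed.

(** The element [1 - y] is a self-adjoint square root of [1 - h * h]. Its square and that of [h] add
    up to 1, so it lies in the unit ball, and hence so does its square. *)
Lemma norm_1B_sqr_le1 h : cs_star h = h -> cs_norm h <= 1 -> cs_norm (1 - h * h) <= 1.
Proof.
move=> sh h1.
have [|y vy _] := @visser_cvg _ _ (h * h); first by rewrite cs_norm_sa // exprn_ile1 ?cs_norm_ge0.
have sy : cs_star (1 - y) = 1 - y.
  by rewrite cs_starB cs_star1 (visser_sa _ vy) // cs_starM sh.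
have yh : h * y = y * h by apply: (visser_intertwine vy vy); rewrite mulrA.
have y1 : cs_norm (1 - y) <= 1.
  apply: (@norm_le1_sqrD _ h) => //; first exact/esym/commuteB1.
  by rewrite (visser_sqr vy) subrK.
by rewrite -(visser_sqr vy) cs_norm_sa // exprn_ile1 ?cs_norm_ge0.
Qed.

(** With [w = 1 - z] the hypothesis reads [(w - r) (w + r) = 0]. The second factor is [1 + r] times
    [1 - z / (1 + r)], invertible by the Neumann series, so the first factor vanishes. *)
Lemma sqrt_unique z r : cs_norm z <= 1 -> 0 < r ->
  (1 - z) * (1 - z) = ((r * r)%:C)%C *: 1 -> 1 - z = (r%:C)%C *: 1.
Proof.
move=> z1 r0 e; pose rC := (r%:C)%C; pose w := 1 - z.
have r1 : 0 < (1 + r)^-1 by rewrite invr_gt0; lra.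
have [|g [_ Hg]] := @neumann _ _ (((1 + r)^-1%:C)%C *: z).
  rewrite cs_normZ gtr0_norm // mulrC ltr_pdivrMr; first by rewrite mul1r; lra.
  by lra.
have prod0 v : v * v = ((r * r)%:C)%C *: 1 -> (v - rC *: 1) * (v + rC *: 1) = 0 :> A.
  move=> {}e; rewrite mulrBl !mulrDr -!scalerAr -!scalerAl !mulr1 !mul1r scalerA -rmorphM /= -e.
  by rewrite opprD addrA addrK subrr.
have ew : w + rC *: 1 = ((1 + r)%:C)%C *: (1 - ((1 + r)^-1%:C)%C *: z).
  rewrite scalerBr scalerA -rmorphM /= mulfV ?scale1r; last lra.
  by rewrite rmorphD rmorph1 scalerDl scale1r /w addrAC.
have /eqP : (w - rC *: 1) * (((1 + r)%:C)%C *: 1) = 0.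
  have -> : ((1 + r)%:C)%C *: 1 = (w + rC *: 1) * g by rewrite ew -scalerAl Hg.
  by rewrite mulrA (prod0 w e) mul0r.
rewrite -scalerAr mulr1 scaler_eq0 => /orP[/eqP /(congr1 (@complex.Re R)) /=|].
  by move=> rN1; exfalso; clear - r0 rN1; lra.
by rewrite subr_eq0 => /eqP.
Qed.

End Contraction.

Section StarHom.
Variables (R : realType).

(** Norm-closedness is left out so that the increasing union of the algebras generated by finitely
    many of the projections qualifies. *)
Definition unital_star_subalgebra (A : cstarAlgebra R) (S : A -> Prop) :=
  [/\ S 1, forall c a b, S a -> S b -> S (c *: a + b),
      forall a b, S a -> S b -> S (a * b) & forall a, S a -> S (cs_star a)].

Lemma cstar_star_subalgebra (A : cstarAlgebra R) (S : A -> Prop) :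
  unital_cstar_subalgebra S -> unital_star_subalgebra S.
Proof. by case. Qed.

(** Relative to [S] because a cross section is a function on all of [M] whose values matter only on
    its domain; [pi] is the case of the full domain. *)
Definition star_hom_on (A B : cstarAlgebra R) (S : A -> Prop) (f : A -> B) :=
  [/\ forall c a b, S a -> S b -> f (c *: a + b) = c *: f a + f b,
      forall a b, S a -> S b -> f (a * b) = f a * f b,
      forall a, S a -> f (cs_star a) = cs_star (f a)
    & f 1 = 1].

Lemma unital_star_hom_on (A B : cstarAlgebra R) (f : A -> B) :
  unital_star_hom f -> star_hom_on (fun=> True) f.
Proof. by case=> *; split=> *; auto. Qed.

Lemma cross_section_hom_on (A B : cstarAlgebra R) (f : A -> B) S g :
  unital_cross_section f S g -> star_hom_on S g.
Proof. by case. Qed.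

Lemma unital_cstar_subalgebraT (A : cstarAlgebra R) :
  unital_cstar_subalgebra (fun _ : A => True).
Proof. by split. Qed.

Section SubAlg.
Variables (A B : cstarAlgebra R) (S : A -> Prop) (f : A -> B).
Hypotheses (SS : unital_star_subalgebra S) (Hf : star_hom_on S f).

Lemma subalg1 : S 1. Proof. by case: SS. Qed.

Lemma subalgM a b : S a -> S b -> S (a * b). Proof. by case: SS => ? ? + ?; apply. Qed.

Lemma subalg_star a : S a -> S (cs_star a). Proof. by case: SS => ? ? ?; apply. Qed.

Lemma subalg0 : S 0.
Proof. by case: SS => S1 /(_ (-1) _ _ S1 S1); rewrite scaleN1r addNr. Qed.

Lemma subalgZ c a : S a -> S (c *: a).
Proof. by case: SS => _ H _ _ Sa; rewrite -[_ *: _]addr0; apply: H subalg0. Qed.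

Lemma subalgD a b : S a -> S b -> S (a + b).
Proof. by case: SS => _ H _ _ Sa Sb; rewrite -[a]scale1r; apply: H. Qed.

Lemma subalgB a b : S a -> S b -> S (a - b).
Proof. by move=> Sa Sb; rewrite -scaleN1r; apply/subalgD/subalgZ. Qed.

Lemma hom_on1 : f 1 = 1. Proof. by case: Hf. Qed.

Lemma hom_onM a b : S a -> S b -> f (a * b) = f a * f b.
Proof. by case: Hf => ? + ? ?; apply. Qed.

Lemma hom_on_star a : S a -> f (cs_star a) = cs_star (f a).
Proof. by case: Hf => ? ? + ?; apply. Qed.

Lemma hom_on0 : f 0 = 0.
Proof.
case: Hf => /(_ (-1) 1 1 subalg1 subalg1) + _ _ f1.
by rewrite !scaleN1r !addNr.
Qed.

Lemma hom_onZ c a : S a -> f (c *: a) = c *: f a.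
Proof.
by case: Hf => H _ _ _ Sa; rewrite -[c *: a]addr0 H ?hom_on0 ?addr0 //; apply: subalg0.
Qed.

Lemma hom_onD a b : S a -> S b -> f (a + b) = f a + f b.
Proof. by case: Hf => H _ _ _ Sa Sb; rewrite -[a]scale1r H // !scale1r. Qed.

Lemma hom_onB a b : S a -> S b -> f (a - b) = f a - f b.
Proof.
by move=> Sa Sb; have Sb' := subalgZ (-1) Sb; rewrite -(scaleN1r b) hom_onD // hom_onZ // scaleN1r.
Qed.

Lemma subalg_visser x n : S x -> S (visser x n).
Proof.
move=> Sx; elim: n => [|n IH]; first exact: subalg0.
by apply/subalgZ/subalgD => //; apply: subalgM.
Qed.

Lemma hom_on_visser x n : S x -> f (visser x n) = visser (f x) n.
Proof.
move=> Sx; elim: n => [|n IH] /=; first exact: hom_on0.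
have Sv := subalg_visser n Sx; have Sv2 := subalgM Sv Sv.
by rewrite hom_onZ ?hom_onD ?hom_onM ?IH //; apply: subalgD.
Qed.

End SubAlg.

(** For self-adjoint [h] in [S] of norm at most 1, the square root [k] of [1 - h * h] stays in the
    closed set [S], and [f] preserves the relation [h * h + k * k = 1], which bounds the norm of
    [f h]. The general case applies this to [cs_star a * a], divided by its norm, and uses the
    C*-identity. *)
Lemma hom_on_contractive (A B : cstarAlgebra R) (S : A -> Prop) (f : A -> B) a :
  unital_cstar_subalgebra S -> star_hom_on S f -> S a -> cs_norm (f a) <= cs_norm a.
Proof.
move=> SC Hf; have SS := cstar_star_subalgebra SC.
have sacase h : S h -> cs_star h = h -> cs_norm h <= 1 -> cs_norm (f h) <= 1.
  move=> Sh sh h1.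
  have [|y vy _] := @visser_cvg _ _ (h * h).
    by rewrite cs_norm_sa // exprn_ile1 ?cs_norm_ge0.
  have Sy : S y.
    case: SC => _ _ _ _ cl; apply: (cl _ _ _ vy) => n.
    exact: (subalg_visser SS n (subalgM SS Sh Sh)).
  have Sk := subalgB SS (subalg1 SS) Sy.
  have sy : cs_star (1 - y) = 1 - y.
    by rewrite cs_starB cs_star1 (visser_sa _ vy) // cs_starM sh.
  have yh : h * y = y * h by apply: (visser_intertwine vy vy); rewrite mulrA.
  apply: (@norm_le1_sqrD _ _ (f h) (f (1 - y))).
  - by rewrite -(hom_on_star Hf) ?sh.
  - by rewrite -(hom_on_star Hf) ?sy.
  - by rewrite -!(hom_onM Hf) // commuteB1.
  - rewrite -!(hom_onM Hf) // (visser_sqr vy) -(hom_onD Hf).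
    + by rewrite addrC subrK (hom_on1 Hf).
    + exact: subalgM.
    + by apply: (subalgB SS) (subalg1 SS) _; apply: subalgM.
move=> Sa; set m := cs_norm a; have m0 : 0 <= m := cs_norm_ge0 a.
have [mz|mz] := eqVneq m 0.
  by rewrite (cs_norm_eq0 mz) (hom_on0 SS Hf) cs_norm0.
have mp : 0 < m by rewrite lt0r mz.
have Saa : S (cs_star a * a) by apply: subalgM => //; apply: subalg_star.
have m2 : 0 < (m ^+ 2)^-1 by rewrite invr_gt0 exprn_gt0.
have := sacase ((((m ^+ 2)^-1)%:C)%C *: (cs_star a * a)) (subalgZ SS _ Saa).
rewrite (hom_onZ SS Hf) // (hom_onM Hf) ?(hom_on_star Hf) //; last exact: subalg_star.
rewrite cs_starZr cs_starM cs_starK !cs_normZ !cs_normC gtr0_norm // mulVf; last first.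
  by rewrite expf_neq0.
move=> /(_ erefl (lexx _)); rewrite mulrC ler_pdivrMr ?exprn_gt0 // mul1r.
by rewrite ler_pXn2r // nnegrE cs_norm_ge0.
Qed.

Lemma hom_on_tends (A B : cstarAlgebra R) (S : A -> Prop) (f : A -> B) u l :
  unital_cstar_subalgebra S -> star_hom_on S f -> (forall n, S (u n)) ->
  tends u l -> tends (fun n => f (u n)) (f l).
Proof.
move=> SC Hf Su ul; have SS := cstar_star_subalgebra SC.
have Sl : S l by case: SC => _ _ _ _ H; apply: H ul.
move=> e /ul[N HN]; exists N => n /HN; apply: le_lt_trans.
rewrite -(hom_onB SS Hf) //; apply: hom_on_contractive SC Hf _.
exact: subalgB.
Qed.

End StarHom.

(** * Lifting symmetries and projections *)

Section Lifting.
Variables (R : realType) (B M : cstarAlgebra R) (pi : B -> M).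
Hypothesis pi_hom : unital_star_hom pi.
Implicit Types (a b x y z c : B) (s : M).

Let pi_on := unital_star_hom_on pi_hom.
Let piM a b : pi (a * b) = pi a * pi b. Proof. exact: (hom_onM pi_on). Qed.
Let piB a b : pi (a - b) = pi a - pi b.
Proof. by apply: (hom_onB _ pi_on) => //; split. Qed.
Let pi1 : pi 1 = 1. Proof. by case: pi_on. Qed.
Let piZ (k : R[i]) a : pi (k *: a) = k *: pi a.
Proof. by apply: (hom_onZ _ pi_on) => //; split. Qed.
Let pi_star a : pi (cs_star a) = cs_star (pi a). Proof. exact: (hom_on_star pi_on). Qed.
Let pi_le a : cs_norm (pi a) <= cs_norm a.
Proof. exact: hom_on_contractive (unital_cstar_subalgebraT _) pi_on _. Qed.

(* The symmetry is the sign [b |b|^-1] of [b]. *)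
Lemma lift_symmetry_of_invertible b : cs_star b = b -> invertible b ->
  pi b * pi b = 1 ->
  exists c, [/\ cs_star c = c, c * c = 1, pi c = pi b &
    forall z, z * b = b * z -> z * c = c * z].
Proof.
move=> sb [bi [bbi bib]] pib2.
pose r := 1 + cs_norm b; have r0 : 0 < r by have := cs_norm_ge0 b; rewrite /r; lra.
have ri0 : 0 < r^-1 by rewrite invr_gt0.
pose h := ((r^-1)%:C)%C *: b.
have sh : cs_star h = h by rewrite cs_starZr sb.
have h1 : cs_norm h <= 1.
  by rewrite cs_normZ gtr0_norm // mulrC ler_pdivrMr // mul1r /r; lra.
(* Taking the square root of [1 - (1 - h * h)] makes [1 - y] the absolute value of [h]. *)
have [y vy y1] := visser_cvg (norm_1B_sqr_le1 sh h1).
have vh : (1 - y) * (1 - y) = h * h by rewrite (visser_sqr vy) opprB addrC subrK.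
have comm z : z * b = b * z -> z * y = y * z.
  move=> zb; apply: (visser_intertwine vy vy); apply: commuteB1.
  have zh : z * h = h * z by rewrite -scalerAr -scalerAl zb.
  by rewrite mulrA zh -!mulrA zh.
have sy : cs_star y = y.
  by apply: visser_sa vy; rewrite cs_starB cs_star1 cs_starM sh.
pose t := 1 - y.
have tbi : bi * t = t * bi by apply/commuteB1/comm; rewrite bib bbi.
(* Both [pi t] and the scalar [r^-1] square to [r^-2], and [pi t] is 1 minus the element [pi y] of
   the unit ball, so uniqueness of the square root applies. *)
have pit : pi t = ((r^-1)%:C)%C *: 1.
  rewrite /t piB pi1; apply: sqrt_unique => //; first exact: le_trans (pi_le y) y1.
  rewrite -pi1 -piB -piM vh piM !piZ -scalerAl -scalerAr pib2 scalerA pi1.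
  by rewrite rmorphM.
have pibi : pi bi = pi b.
  by rewrite -[LHS]mul1r -pib2 -mulrA -piM bbi pi1 mulr1.
have rC : ((r%:C) * (r^-1)%:C = 1 :> R[i])%C by rewrite -rmorphM /= mulfV ?gt_eqF.
(* Here [r t] is [|b|]. The product of [|b|] with the inverse of [b] is again the sign of [b], and
   only the inverse of [b] itself occurs. *)
exists ((r%:C)%C *: (t * bi)); split.
- by rewrite cs_starZr cs_starM (inverse_sa bbi bib sb) cs_starB cs_star1 sy -/t tbi.
- have hbi : h * bi = ((r^-1)%:C)%C *: 1 by rewrite -scalerAl bbi.
  have tt : t * bi * (t * bi) = ((r^-1)%:C)%C *: (((r^-1)%:C)%C *: 1).
    rewrite mulrA -[t * bi * t]mulrA tbi mulrA vh -[h * h * bi]mulrA hbi.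
    by rewrite -scalerAr mulr1 -scalerAl hbi.
  rewrite -scalerAl -scalerAr tt [X in _ *: X]scalerA rC scale1r.
  by rewrite scalerA rC scale1r.
- by rewrite piZ piM pit pibi -scalerAl mul1r scalerA rC scale1r.
- move=> z zb; rewrite -scalerAr -scalerAl mulrA (commuteB1 (comm _ zb)) -!mulrA.
  by rewrite (inverse_comm bbi bib zb).
Qed.

(* With [d = a - b] and [w = (1 - a d)^(1/2)], the identity [s w = w^* s] in [M]
   gives [pi b = s (1 - s pi d) = w^* s w]. *)
Lemma lift_invertible_near a b : cs_star a = a -> pi a * pi a = 1 ->
  cs_star b = b -> invertible b -> cs_norm (a * (a - b)) < 1 ->
  exists b', [/\ cs_star b' = b', invertible b', pi b' = pi a &
    forall z, cs_star z = z -> z * a = a * z -> z * b = b * z -> z * b' = b' * z].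
Proof.
move=> sa s2 sb [bi [bbi bib]] ad1; set d := a - b in ad1.
have sd : cs_star d = d by rewrite cs_starB sa sb.
have [y vy _] := visser_cvg (ltW ad1).
have [g [gx xg]] := neumann ad1.
pose w := 1 - y; have ww : w * w = 1 - a * d := visser_sqr vy.
have wg : w * g = g * w by apply: inverse_comm xg gx _; rewrite -ww mulrA.
have [v [vw wv v_comm]] : exists v, [/\ v * w = 1, w * v = 1 &
    forall z, z * (a * d) = a * d * z -> z * v = v * z].
  exists (g * w); split; first by rewrite -mulrA ww gx.
    by rewrite -wg mulrA ww xg.
  move=> z zad; have zw : z * w = w * z by apply/commuteB1/(visser_intertwine vy vy).
  by rewrite mulrA (inverse_comm xg gx (commuteB1 zad)) -!mulrA zw.
(* Put [s = pi a]. Since [s] squares to 1, it intertwines [s * pi d] with the adjoint [pi d * s],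
   and the relation passes to the square roots. *)
have spid : pi a * pi w = cs_star (pi w) * pi a.
  have pvy : tends (visser (pi (a * d))) (pi y).
    move=> e e0.
    have [N HN] := hom_on_tends (unital_cstar_subalgebraT _) pi_on (fun=> I) vy e0.
    by exists N => n /HN; rewrite (hom_on_visser _ pi_on) //; split.
  have H : pi a * pi y = cs_star (pi y) * pi a.
    apply: (visser_intertwine pvy (tends_visser_star pvy)).
    by rewrite -pi_star cs_starM sa sd !piM mulrA s2 -mulrA s2 mulr1 mul1r.
  by rewrite piB pi1 mulrBr H cs_starB cs_star1 mulrBl mul1r mulr1.
have pib : pi b = cs_star (pi w) * pi a * pi w.
  rewrite -spid -mulrA -piM ww -piM mulrBr mulr1 piB mulrA !piM s2 mul1r -piB.
  by rewrite /d subKr.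
(* As [pi b] is [pi a] conjugated by [pi w], conjugating [b] by the inverse [v] of [w] recovers
   [pi a] exactly and keeps self-adjointness and invertibility. *)
exists (cs_star v * b * v); split.
- by rewrite !cs_starM cs_starK sb mulrA.
- exists (w * bi * cs_star w); split.
  + rewrite -!mulrA [v * (w * _)]mulrA vw mul1r [b * (bi * _)]mulrA bbi mul1r.
    by rewrite -cs_starM wv cs_star1.
  + rewrite -!mulrA [cs_star w * (cs_star v * _)]mulrA -cs_starM vw cs_star1 mul1r.
    by rewrite [bi * (b * _)]mulrA bib mul1r.
- rewrite !piM pib pi_star !mulrA -cs_starM -piM wv pi1 cs_star1 mul1r -mulrA -piM wv.
  by rewrite pi1 mulr1.
- move=> z sz za zb; have zad : z * (a * d) = (a * d) * z.
    by rewrite mulrA za -!mulrA mulrBr mulrBl za zb.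
  have zv := v_comm _ zad.
  have zsv : z * cs_star v = cs_star v * z by rewrite -{1}sz -!cs_starM -zv cs_starM sz.
  by rewrite !mulrA zsv -[_ * z * b]mulrA zb -!mulrA zv.
Qed.

End Lifting.

(** * Density of invertible self-adjoint elements *)

Section InvertibleDensity.
Variables (R : realType) (B : cstarAlgebra R).
Implicit Types (a b x y z q : B) (e d : R).

Lemma proj_compl q : projection q -> projection (1 - q).
Proof.
move=> [sq qq]; split; first by rewrite cs_starB cs_star1 sq.
by rewrite mulrBl mul1r mulrBr mulr1 qq subrr subr0.
Qed.

Lemma proj_mulC0 q : projection q -> q * (1 - q) = 0.
Proof. by case=> _ qq; rewrite mulrBr mulr1 qq subrr. Qed.

Lemma proj_compl_mul0 q : projection q -> (1 - q) * q = 0.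
Proof. by case=> _ qq; rewrite mulrBl mul1r qq subrr. Qed.

(** Used on a finite spectrum: all sufficiently small positive reals avoid it, so small real shifts
    are invertible. *)
Lemma real_notin_seq (s : seq R[i]) e : 0 < e ->
  exists2 d, 0 < d <= e & forall t, 0 < t < d -> (t%:C)%C \notin s.
Proof.
move=> e0; elim: s => [|c s [d /andP[d0 de] H]]; first by exists e; rewrite ?e0 ?lexx.
have [c0|c0] := ltP 0 (complex.Re c).
  exists (Num.min d (complex.Re c)); first by rewrite lt_min d0 c0 ge_min de.
  move=> t; rewrite lt_min => /and3P[t0 td tc]; rewrite inE negb_or H ?t0 ?td // andbT.
  by apply/eqP => tE; move: tc; rewrite -tE ltxx.
exists d; rewrite ?d0 // => t /andP[t0 td]; rewrite inE negb_or H ?t0 ?td // andbT.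
by apply/eqP => tE; move: c0; rewrite -tE leNgt t0.
Qed.

(** Half of the error goes to an approximant [b] with finite spectrum, the rest to subtracting a
    small positive real [t] outside that spectrum. As [t] is real, self-adjointness survives. *)
Lemma invertible_sa_dense : real_rank_zero B -> forall a e, cs_star a = a -> 0 < e ->
  exists b, [/\ cs_star b = b, invertible b & cs_norm (a - b) < e].
Proof.
move=> rr a e sa e0; have e2 : 0 < e / 2 by lra.
have [b [sb [[s Hs] ab]]] := rr a sa _ e2.
have [d /andP[d0 de] Hd] := real_notin_seq s e2.
pose t := d / 2; have td : 0 < t < d by rewrite /t; clear - d0; lra.
exists (b - ((t%:C)%C)%:A); split.
- by rewrite cs_starB sb cs_starZr cs_star1.
- by apply: contrapT => /Hs; apply/negP/Hd.
- rewrite opprB addrCA addrC; apply: le_lt_trans (cs_normD _ _) _.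
  have [t0 td'] := andP td; have := cs_norm1 B; have := cs_norm_ge0 (1 : B).
  rewrite cs_normZ gtr0_norm // => n0 n1.
  have : t * cs_norm (1 : B) <= t by rewrite ger_pMr.
  clear - ab td' de; lra.
Qed.

(* [x] is the Schur complement of the block [(1 - q) b (1 - q)] in [b]; its inverse
   in the corner is the [q]-block of the inverse of [b]. *)
Lemma schur_complement q a b d : projection q -> q * a = a * q -> cs_star b = b ->
  invertible b -> d <= 2^-1 -> cs_norm (b - (a * q + (1 - q))) <= d ->
  exists x x', [/\ cs_star x = x /\ q * x = x, x * x' = q /\ x' * x = q,
    q * x' = x' /\ x' * q = x',
    cs_norm (x - a * q) <= 2 * d &
    forall z, z * q = q * z -> z * b = b * z -> z * x = x * z].
Proof.
move=> pq qa sb [v [bv vb]] d2.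
have pp := proj_compl pq; have qp := proj_mulC0 pq; have pq0 := proj_compl_mul0 pq.
have qpD : q + (1 - q) = 1 by rewrite addrC subrK.
move: (1 - q) pp qp pq0 qpD => p pp qp pq0 qpD.
have [sq qq] := pq; have [sp p2] := pp.
have q1 := cs_norm_proj_le1 pq; have p1 := cs_norm_proj_le1 pp.
set E := b - _ => Ed.
have bE : b = a * q + p + E by rewrite /E addrC subrK.
have cutn y y' : cs_norm y <= 1 -> cs_norm y' <= 1 -> cs_norm (y * E * y') <= d.
  move=> y1 y1'; apply: le_trans (cs_normM _ _) _.
  rewrite -[d]mulr1; apply: ler_pM; rewrite ?cs_norm_ge0 //.
  apply: le_trans (cs_normM _ _) _.
  by rewrite -[d]mul1r; apply: ler_pM; rewrite ?cs_norm_ge0.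
have aqp : a * q * p = 0 by rewrite -mulrA qp mulr0.
have paq : p * (a * q) = 0 by rewrite -qa mulrA pq0 mul0r.
have pbp : p * b * p = p + p * E * p.
  by rewrite bE !mulrDr !mulrDl paq mul0r add0r !p2.
have qbp : q * b * p = q * E * p.
  by rewrite bE !mulrDr !mulrDl qp mul0r addr0 -[q * _ * p]mulrA aqp mulr0 add0r.
have pbq : p * b * q = p * E * q.
  by rewrite bE !mulrDr !mulrDl paq mul0r add0r p2 pq0 add0r.
have qbq : q * b * q = a * q + q * E * q.
  rewrite bE !mulrDr !mulrDl qp mul0r addr0 -qa !mulrA qq qa -[a * q * q]mulrA qq.
  by rewrite -!mulrA.
have d1 : d < 1 by clear - d2; lra.
have pEp1 : cs_norm (- (p * E * p)) < 1.
  by rewrite cs_normN; apply: le_lt_trans (cutn _ _ p1 p1) d1.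
have [g [gc cg]] := neumann pEp1.
have d0 : 0 <= d by apply: le_trans (cs_norm_ge0 _) Ed.
(* From [g = 1 - g * (p * E * p)] and [d <= 2^-1], the norm of [g] is at most 1 plus half of
   itself. *)
have g2 : cs_norm g <= 2.
  have : g = 1 + g * - (p * E * p) by rewrite mulrN -[in 1 + _]gc mulrBr mulr1 mulrN opprK addrK.
  move/(congr1 (@cs_norm _ B)) => g1.
  have h1 := cs_normD 1 (g * - (p * E * p)); have h2 := cs_normM g (- (p * E * p)).
  have h3 := cs_norm1 B; have h4 : cs_norm g * cs_norm (- (p * E * p)) <= cs_norm g * 2^-1.
    by apply: ler_wpM2l; rewrite ?cs_norm_ge0 // cs_normN; apply: le_trans (cutn _ _ p1 p1) d2.
  rewrite -g1 in h1; clear - h1 h2 h3 h4; lra.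
(* The element inverted by [g] is [q + p * b * p], so [g] inverts the block [p * b * p] in the
   corner of [p]. *)
have gpbp : g * (p * b * p) = p.
  have -> : p * b * p = (1 - - (p * E * p)) * p.
    by rewrite opprK mulrDl mul1r -!mulrA p2 !mulrA pbp.
  by rewrite mulrA gc mul1r.
have gE : 1 - - (p * E * p) = q + p * b * p by rewrite opprK -qpD -addrA -pbp.
have sg : cs_star g = g.
  by apply: inverse_sa cg gc _; rewrite gE cs_starD !cs_starM sq sp sb mulrA.
pose x := q * b * q - q * b * p * g * (p * b * q).
have sx : cs_star x = x by rewrite /x cs_starB !cs_starM sq sp sb sg !mulrA.
have sv : cs_star v = v by apply: inverse_sa bv vb sb.
have xv : x * (q * v * q) = q.
  (* Splitting [b * v = 1] along [q + p = 1] turns [p * b * q * v * q] into [- (p * b * p * v * q)].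
     Then [g] cancels the block [p * b * p], and the two terms of [x * (q * v * q)] recombine to
     [q * b * v * q = q]. *)
  have bvq : b * q * v = 1 - b * p * v.
    by rewrite -[q](addrK p) qpD mulrBr mulr1 mulrBl bv.
  have h : p * b * q * (q * v * q) = - (p * b * p * v * q).
    rewrite !mulrA -[_ * q * q]mulrA qq.
    have -> : p * b * q * v = p - p * b * p * v.
      by rewrite -!mulrA [b * (q * _)]mulrA bvq mulrBr mulr1 !mulrA.
    by rewrite mulrBl pq0 add0r.
  rewrite /x mulrBl -[_ * g * _ * _]mulrA h mulrN opprK.
  have -> : q * b * p * g * (p * b * p * v * q) = q * b * p * v * q.
    rewrite !mulrA -[_ * g * p]mulrA -[_ * (g * p) * b]mulrA -[_ * (g * p * b) * p]mulrA.
    by rewrite -[g * p * b]mulrA -[g * (p * b) * p]mulrA gpbp -[_ * p * p]mulrA p2.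
  rewrite !mulrA -[_ * q * q]mulrA qq -!mulrDl -mulrDr qpD mulr1.
  by rewrite -[q * b * v]mulrA bv mulr1 qq.
have qx : q * x = x by rewrite /x mulrBr !mulrA qq.
have xq : x * q = x by rewrite -{1}sx -{1}sq -cs_starM qx sx.
exists x, (q * v * q); split.
- by [].
- split=> //; apply: (can_inj (@cs_starK _ B)).
  by rewrite cs_starM sx !cs_starM sq sv [q * (v * q)]mulrA xv.
- by split; rewrite -?mulrA ?qq // !mulrA qq.
- have -> : x - a * q = q * E * q - q * E * p * g * (p * E * q).
    by rewrite /x qbq qbp pbq addrAC [a * q + _]addrC addrK.
  apply: le_trans (cs_normD _ _) _; rewrite cs_normN.
  have h1 := cutn _ _ q1 q1; have h2 := cutn _ _ q1 p1; have h3 := cutn _ _ p1 q1.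
  have h4 : cs_norm (q * E * p * g * (p * E * q)) <= d * 2 * d.
    apply: le_trans (cs_normM _ _) _; apply: ler_pM; rewrite ?cs_norm_ge0 //.
    by apply: le_trans (cs_normM _ _) _; apply: ler_pM; rewrite ?cs_norm_ge0.
  have h5 : d * 2 * d <= d * 2 * 2^-1 by apply: ler_wpM2l => //; clear - d0; lra.
  clear - h1 h4 h5; lra.
- move=> z zq zb; have zp : z * p = p * z.
    by rewrite -[p](addrK q) [p + q]addrC qpD mulrBr mulrBl mulr1 mul1r zq.
  have zg : z * g = g * z.
    apply: inverse_comm cg gc _; rewrite gE mulrDr mulrDl zq; congr (_ + _).
    by rewrite !mulrA zp -!mulrA; congr (_ * _); rewrite !mulrA zb -!mulrA zp.
  rewrite /x mulrBr mulrBl; congr (_ - _).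
    by rewrite !mulrA zq -[q * z * b]mulrA zb !mulrA -[_ * z * q]mulrA zq !mulrA.
  rewrite !mulrA zq -[q * z * b]mulrA zb !mulrA -[_ * z * p]mulrA zp !mulrA.
  rewrite -[_ * z * g]mulrA zg !mulrA -[_ * z * p]mulrA zp !mulrA.
  by rewrite -[_ * z * b]mulrA zb !mulrA -[_ * z * q]mulrA zq !mulrA.
Qed.

(** Induction on [l]. To add [q], approximate [a * q + (1 - q)] and [a * (1 - q) + q] by invertibles
    commuting with [l], and cut each to its corner by a Schur complement. The sum of the two corners
    is block diagonal for [q], is invertible, and still commutes with [l]. *)
Lemma invertible_dense_commutant (l : seq B) : real_rank_zero B ->
  (forall q, q \in l -> projection q) ->
  (forall q q', q \in l -> q' \in l -> q * q' = q' * q) ->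
  forall a e, cs_star a = a -> (forall q, q \in l -> q * a = a * q) -> 0 < e ->
  exists b, [/\ cs_star b = b, invertible b, cs_norm (a - b) < e &
    forall q, q \in l -> q * b = b * q].
Proof.
move=> rr; elim: l => [|q l IH] pl cl a e sa ca e0.
  by have [b [sb ib ab]] := invertible_sa_dense rr sa e0; exists b.
have ql : q \in q :: l by rewrite mem_head.
have inl q' : q' \in l -> q' \in q :: l by rewrite inE orbC => ->.
have pq := pl _ ql; have pp := proj_compl pq.
have qa := ca _ ql.
have [sq qq] := pq.
have pa : (1 - q) * a = a * (1 - q) by apply/esym/commuteB1/esym.
(* The Schur complements need [d <= 2^-1]; each costs [2 d], so [d <= e / 8] keeps the sum at most
   [e / 2]. *)
pose d := Num.min 2^-1 (e / 8).
have d0 : 0 < d by rewrite lt_min; apply/andP; split; clear - e0; lra.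
have d2 : d <= 2^-1 by rewrite ge_min lexx.
have de : d <= e / 8 by rewrite ge_min lexx orbT.
have near p : projection p -> p * a = a * p ->
    (forall q', q' \in l -> q' * p = p * q') ->
    exists b, [/\ cs_star b = b, invertible b, cs_norm (b - (a * p + (1 - p))) <= d &
      forall q', q' \in l -> q' * b = b * q'].
  move=> projp pa' lp; have [sp _] := projp.
  have := IH _ _ (a * p + (1 - p)) d; case=> //.
  - by move=> q' /inl; apply: pl.
  - by move=> q1 q2 /inl h1 /inl h2; apply: cl.
  - by rewrite cs_starD cs_starM sp sa pa' cs_starB cs_star1 sp.
  - move=> q' q'l; rewrite mulrDr mulrDl (commuteB1 (lp _ q'l)) !mulrA ca ?inl //.
    by rewrite -!mulrA lp.
  - by move=> b [? ? ? ?]; exists b; split=> //; rewrite cs_distC; apply: ltW.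
have clq q' : q' \in l -> q' * q = q * q' by move=> /inl /cl; apply.
have clp q' : q' \in l -> q' * (1 - q) = (1 - q) * q' by move=> /clq/commuteB1.
have [b1 [sb1 ib1 ab1 cb1]] := near q pq (ca _ ql) clq.
have [b2 [sb2 ib2 ab2 cb2]] := near _ pp pa clp.
have [x [x' [[sx qx] [xx' x'x] [qx' x'q] nx cx]]] := schur_complement pq qa sb1 ib1 d2 ab1.
have [y [y' [[sy py] [yy' y'y] [py' y'p] ny cy]]] := schur_complement pp pa sb2 ib2 d2 ab2.
have xq : x * q = x by rewrite -{1}sx -{1}sq -cs_starM qx sx.
have qp0 := proj_mulC0 pq; have pq0 := proj_compl_mul0 pq.
have yp : y * (1 - q) = y.
  by rewrite -{1}sy -[1 - q](proj1 pp) -cs_starM py sy.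
exists (x + y); split.
- by rewrite cs_starD sx sy.
- exists (x' + y'); split; rewrite mulrDl !mulrDr.
  + rewrite xx' yy' -xq -py' mulrA -[x * q * _]mulrA qp0 mulr0 mul0r addr0.
    by rewrite -yp -qx' mulrA -[y * _ * q]mulrA pq0 mulr0 mul0r add0r addrC subrK.
  + rewrite x'x y'y -x'q -py mulrA -[x' * q * _]mulrA qp0 mulr0 mul0r addr0.
    by rewrite -y'p -qx mulrA -[y' * _ * q]mulrA pq0 mulr0 mul0r add0r addrC subrK.
- have -> : a - (x + y) = (a * q - x) + (a * (1 - q) - y).
    by rewrite addrACA -mulrDr [q + _]addrC subrK mulr1 opprD.
  apply: le_lt_trans (cs_normD _ _) _; rewrite !(cs_distC (a * _)).
  clear - nx ny de e0; lra.
- move=> q'; rewrite inE => /orP[/eqP ->|q'l].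
    rewrite mulrDr mulrDl qx xq -{1}py mulrA qp0 mul0r addr0.
    by rewrite -yp -mulrA pq0 mulr0 addr0.
  by rewrite mulrDr mulrDl (cx _ (clq _ q'l) (cb1 _ q'l)) (cy _ (clp _ q'l) (cb2 _ q'l)).
Qed.

End InvertibleDensity.

(** Members may be 0, since refining by a further projection can produce zero pieces. Coefficients
    of a combination are then determined only at the nonzero members. *)
Definition projection_partition (R : realType) (A : cstarAlgebra R) (J : finType)
    (q : J -> A) :=
  [/\ forall j, projection (q j), forall i j, i != j -> q i * q j = 0
    & \sum_j q j = 1].

(** * Lifting a projection in the commutant of a partition *)

Section LiftProjection.
Variables (R : realType) (B M : cstarAlgebra R) (pi : B -> M).

Lemma partition_commute (A : cstarAlgebra R) (J : finType) (q : J -> A) i j :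
  projection_partition q -> q i * q j = q j * q i.
Proof.
case=> _ q0 _; have [->//|ij] := eqVneq i j.
by rewrite !q0 // eq_sym.
Qed.

Lemma projection_of_symmetry (A : cstarAlgebra R) (c : A) :
  cs_star c = c -> c * c = 1 -> projection (((2^-1 : R)%:C)%C *: (1 + c)).
Proof.
move=> sc cc; split; first by rewrite cs_starZr cs_starD cs_star1 sc.
rewrite -scalerAl -scalerAr; congr (_ *: _).
by rewrite mulrDl mul1r mulrDr mulr1 cc [c + 1]addrC cs_halfK.
Qed.

Lemma lift_projection (J : finType) (q : J -> B) (p : M) :
  real_rank_zero B -> unital_star_hom pi -> (forall m, exists b, pi b = m) ->
  projection_partition q -> projection p ->
  (forall j, p * pi (q j) = pi (q j) * p) ->
  exists P, [/\ projection P, pi P = p & forall j, P * q j = q j * P].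
Proof.
move=> rr hom surj parq [sp pp] pq.
have pi_on := unital_star_hom_on hom; have SB := cstar_star_subalgebra (unital_cstar_subalgebraT B).
have [proj_q q0 q1] := parq.
pose s := p + p - 1.
have ss : s * s = 1.
  by rewrite /s mulrBl mul1r mulrBr mulr1 mulrDl !mulrDr !pp addrK opprB addrC subrK.
have s_sa : cs_star s = s by rewrite cs_starB cs_starD sp cs_star1.
have [z piz] := surj s.
pose a0 := ((2^-1 : R)%:C)%C *: (z + cs_star z).
have sa0 : cs_star a0 = a0 by rewrite cs_starZr cs_starD cs_starK addrC.
have pia0 : pi a0 = s.
  by rewrite (hom_onZ SB pi_on) // (hom_onD pi_on) // (hom_on_star pi_on) // piz s_sa cs_halfK.
(* Compressing [a0] to its diagonal blocks makes it commute with each [q j]. It still lifts [s],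
   because [s] commutes with the projections [pi (q j)], which sum to 1. *)
pose a := \sum_j q j * a0 * q j.
have sa : cs_star a = a.
  rewrite cs_star_sum; apply: eq_bigr => j _.
  by have [sq _] := proj_q j; rewrite !cs_starM sa0 sq mulrA.
have pi_sum (F : J -> B) : pi (\sum_j F j) = \sum_j pi (F j).
  apply: (big_morph pi) => [x y|]; first exact: (hom_onD pi_on).
  exact: (hom_on0 SB pi_on).
have pia : pi a = s.
  rewrite pi_sum -[RHS]mulr1 -(hom_on1 pi_on) -q1 pi_sum mulr_sumr.
  apply: eq_bigr => j _; have [_ qq] := proj_q j.
  rewrite !(hom_onM pi_on) // pia0.
  have -> : pi (q j) * s = s * pi (q j).
    by rewrite /s mulrBl mulrBr mulrDl mulrDr pq mulr1 mul1r.
  by rewrite -mulrA -(hom_onM pi_on) // qq.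
have qj_sum (F : J -> B) j : q j * (\sum_i q i * F i) = q j * F j.
  rewrite mulr_sumr (bigD1 j) //= big1 ?addr0 => [|i ij].
    by have [_ qq] := proj_q j; rewrite mulrA qq.
  by rewrite mulrA q0 ?mul0r // eq_sym.
have qa j : q j * a = a * q j.
  have -> : q j * a = q j * a0 * q j.
    rewrite -[RHS]mulrA -(qj_sum (fun i => a0 * q i)); congr (_ * _).
    by apply: eq_bigr => i _; rewrite mulrA.
  rewrite mulr_suml (bigD1 j) //= big1 ?addr0 => [|i ij].
    by have [_ qq] := proj_q j; rewrite -[RHS]mulrA qq.
  by rewrite -mulrA q0 // mulr0.
pose l := codom q.
(* With this tolerance the norm of [a * (a - b)] is at most [cs_norm a / (1 + cs_norm a)], hence
   below 1. *)
have e0 : 0 < (1 + cs_norm a)^-1.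
  by rewrite invr_gt0; have := cs_norm_ge0 a; lra.
have [|||b [sb ib ab cb]] := @invertible_dense_commutant _ _ l rr _ _ a _ sa _ e0.
- by move=> _ /codomP[j ->].
- by move=> _ _ /codomP[i ->] /codomP[j ->]; apply: partition_commute.
- by move=> _ /codomP[j ->].
have ab1 : cs_norm (a * (a - b)) < 1.
  apply: le_lt_trans (cs_normM _ _) _; have a1 := cs_norm_ge0 a.
  have : cs_norm a * cs_norm (a - b) <= cs_norm a * (1 + cs_norm a)^-1.
    by apply: ler_wpM2l => //; apply: ltW.
  move/le_lt_trans; apply; rewrite ltr_pdivrMr; clear - a1; lra.
have [b' [sb' ib' pib' cb']] : exists b', [/\ cs_star b' = b', invertible b', pi b' = pi a &
    forall z, cs_star z = z -> z * a = a * z -> z * b = b * z -> z * b' = b' * z].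
  by apply: (lift_invertible_near hom sa _ sb ib ab1); rewrite pia ss.
have [|c [sc cc pic comc]] := lift_symmetry_of_invertible hom sb' ib'.
  by rewrite pib' pia ss.
exists (((2^-1 : R)%:C)%C *: (1 + c)); split.
- exact: projection_of_symmetry.
- rewrite (hom_onZ SB pi_on) // (hom_onD pi_on) // (hom_on1 pi_on) pic pib' pia.
  by rewrite /s addrC subrK cs_halfK.
- move=> j; rewrite -scalerAl -scalerAr mulrDl mulrDr mul1r mulr1 comc //.
  have [sq _] := proj_q j; apply: cb' => //; apply: cb; exact: codom_f.
Qed.

End LiftProjection.

(** * Finite-dimensional commutative subalgebras *)

Section ScalarLimits.
Variable R : realType.

(** The limit is the supremum of the eventual lower bounds, that is, the lower limit. *)
Lemma real_cauchy_cvg (a : nat -> R) :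
  (forall e, 0 < e -> exists N, forall n, (N <= n)%N -> `|a n - a N| < e) ->
  exists l, forall e, 0 < e -> exists N, forall n, (N <= n)%N -> `|a n - l| < e.
Proof.
move=> H; pose E : classical_sets.set R := fun t => exists N, forall n, (N <= n)%N -> t <= a n.
have ubE N e : (forall n, (N <= n)%N -> `|a n - a N| < e) ->
    classical_sets.ubound E (a N + e).
  move=> HN t [N' HN'].
  have := HN _ (leq_maxl N N'); have := HN' _ (leq_maxr N N').
  by rewrite ltr_norml => h /andP[_ h']; clear - h h'; lra.
have inE N e : (forall n, (N <= n)%N -> `|a n - a N| < e) -> E (a N - e).
  by move=> HN; exists N => n /HN; rewrite ltr_norml => /andP[h _]; clear - h; lra.
have [N1 HN1] := H 1 ltr01.
have hasE : classical_sets.has_ubound E by exists (a N1 + 1); apply: ubE.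
exists (sup E) => e e0; have e2 : 0 < e / 2 by clear - e0; lra.
have [N HN] := H _ e2; exists N => n /HN.
have : a N - e / 2 <= sup E by apply: ub_le_sup => //; apply: inE.
have : sup E <= a N + e / 2 by apply: ge_sup; [exists (a N - e / 2); apply: inE | exact: ubE].
by rewrite !ltr_norml => h1 h2 /andP[h3 h4]; clear - h1 h2 h3 h4; apply/andP; split; lra.
Qed.

Lemma cmodE (c : R[i]) : cmod c = Num.sqrt (complex.Re c ^+ 2 + complex.Im c ^+ 2).
Proof. by rewrite /cmod normc_def. Qed.

Lemma Re_le_cmod (c : R[i]) : `|complex.Re c| <= cmod c.
Proof. by rewrite cmodE -sqrtr_sqr ler_wsqrtr // lerDl sqr_ge0. Qed.

Lemma Im_le_cmod (c : R[i]) : `|complex.Im c| <= cmod c.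
Proof. by rewrite cmodE -sqrtr_sqr ler_wsqrtr // lerDr sqr_ge0. Qed.

Lemma cmod_le (c : R[i]) : cmod c <= `|complex.Re c| + `|complex.Im c|.
Proof.
rewrite cmodE -[leRHS]ger0_norm ?addr_ge0 // -sqrtr_sqr ler_wsqrtr //.
rewrite sqrrD !real_normK ?num_real // -addrA lerD2l lerDr.
by rewrite mulrn_wge0 // mulr_ge0.
Qed.

(** For [v] nonzero the coefficients are Cauchy, since their differences are scaled by the fixed
    positive norm of [v]; their real and imaginary parts converge separately. *)
Lemma line_closed (A : cstarAlgebra R) (c : nat -> R[i]) (v l : A) :
  tends (fun n => c n *: v) l -> exists k, l = k *: v.
Proof.
have [->|v0] := eqVneq v 0.
  move=> cl; exists 0; rewrite scaler0; apply: tends_unique cl _ => e e0.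
  by exists 0%N => n _; rewrite scaler0 subrr cs_norm0.
have nv : 0 < cs_norm v.
  by rewrite lt0r cs_norm_ge0 andbT; apply: contra_neq v0; apply: cs_norm_eq0.
move=> cl.
have cauchy e : 0 < e -> exists N, forall n, (N <= n)%N -> cmod (c n - c N) < e.
  move=> e0; have [|N HN] := cl (e * cs_norm v / 2).
    by rewrite !divr_gt0 ?mulr_gt0.
  exists N => n /HN hn; have hN := HN _ (leqnn N).
  rewrite -(ltr_pM2r nv) -(nrmZ (cs_ax A)) scalerBl -[c n *: v](subrK l) -addrA.
  apply: le_lt_trans (cs_normD _ _) _; rewrite [cs_norm (l - _)]cs_distC.
  clear - hn hN; lra.
have [a Ha] : exists a, forall e, 0 < e -> exists N, forall n, (N <= n)%N ->
    `|complex.Re (c n) - a| < e.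
  apply: real_cauchy_cvg => e /cauchy[N HN]; exists N => n /HN; apply: le_lt_trans.
  by have := Re_le_cmod (c n - c N); case: (c n) (c N) => [? ?] [? ?].
have [b Hb] : exists b, forall e, 0 < e -> exists N, forall n, (N <= n)%N ->
    `|complex.Im (c n) - b| < e.
  apply: real_cauchy_cvg => e /cauchy[N HN]; exists N => n /HN; apply: le_lt_trans.
  by have := Im_le_cmod (c n - c N); case: (c n) (c N) => [? ?] [? ?].
exists (a +i* b)%C; apply: tends_unique cl _ => e e0.
have e2 : 0 < e / cs_norm v / 2 by rewrite !divr_gt0.
have [N1 H1] := Ha _ e2; have [N2 H2] := Hb _ e2.
exists (maxn N1 N2) => n; rewrite geq_max => /andP[/H1 h1 /H2 h2].
rewrite -scalerBl (nrmZ (cs_ax A)) -ltr_pdivlMr //.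
apply: le_lt_trans (cmod_le _) _; move: h1 h2; case: (c n) => x y /= h1 h2.
clear - h1 h2; lra.
Qed.

End ScalarLimits.

Section Generated.
Variables (R : realType) (A : cstarAlgebra R).
Implicit Types G S : A -> Prop.

Lemma cstar_gen_subalgebra G : unital_cstar_subalgebra (cstar_gen G).
Proof.
split=> [S [] //|c a b Ga Gb S SS GS|a b Ga Gb S SS GS|a Ga S SS GS|u l Gu ul S SS GS].
- by have := Ga S SS GS; have := Gb S SS GS; case: SS => _ H _ _ _ ? ?; apply: H.
- by have := Ga S SS GS; have := Gb S SS GS; case: SS => _ _ H _ _ ? ?; apply: H.
- by have := Ga S SS GS; case: SS => _ _ _ H _; apply: H.
- by have Su n := Gu n S SS GS; case: SS => _ _ _ _ H; apply: H ul.
Qed.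

Lemma cstar_gen_incl G x : G x -> cstar_gen G x.
Proof. by move=> Gx S _; apply. Qed.

Lemma cstar_gen_mono G G' x :
  (forall y, G y -> G' y) -> cstar_gen G x -> cstar_gen G' x.
Proof. by move=> GG' Gx S SS G'S; apply: Gx => // y /GG'/G'S. Qed.

End Generated.

Lemma hom_on_sum (R : realType) (A B : cstarAlgebra R) (S : A -> Prop) (f : A -> B)
    (I : finType) (F : I -> A) :
  unital_star_subalgebra S -> star_hom_on S f -> (forall i, S (F i)) ->
  f (\sum_i F i) = \sum_i f (F i).
Proof.
move=> SS Hf SF; suff [] : f (\sum_i F i) = \sum_i f (F i) /\ S (\sum_i F i) by [].
elim/big_rec2: _ => [|i y1 y2 _ [IH Sy]]; first by rewrite (hom_on0 SS Hf); split=> //; apply: subalg0.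
by rewrite (hom_onD Hf) // IH; split=> //; apply: subalgD.
Qed.

Lemma unital_cross_section_sub (R : realType) (B M : cstarAlgebra R) (pi : B -> M)
    (S S' : M -> Prop) g :
  (forall x, S x -> S' x) ->
  unital_cross_section pi S' g -> unital_cross_section pi S g.
Proof. by move=> SS' [? ? ? ? ?]; split; auto. Qed.

Section PartitionSpan.
Variables (R : realType) (A : cstarAlgebra R) (J : finType) (q : J -> A).
Implicit Types (c d : J -> R[i]) (x y : A).

Definition partition_span x := exists c, x = \sum_j c j *: q j.

Hypothesis parq : projection_partition q.

Lemma span_mulr c j : (\sum_i c i *: q i) * q j = c j *: q j.
Proof.
have [pq q0 _] := parq; rewrite mulr_suml (bigD1 j) //= big1 ?addr0 => [|i ij].
  by rewrite -scalerAl; case: (pq j) => _ ->.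
by rewrite -scalerAl q0 // scaler0.
Qed.

Lemma spanM c d :
  (\sum_i c i *: q i) * (\sum_i d i *: q i) = \sum_i (c i * d i) *: q i.
Proof.
rewrite mulr_sumr; apply: eq_bigr => i _.
by rewrite -scalerAr span_mulr scalerA mulrC.
Qed.

Lemma span_star c : cs_star (\sum_i c i *: q i) = \sum_i ((c i)^*)%C *: q i.
Proof.
rewrite cs_star_sum; apply: eq_bigr => i _.
by rewrite cs_starZ; have [pq _ _] := parq; case: (pq i) => -> _.
Qed.

Lemma span_linear (k : R[i]) c d :
  k *: (\sum_i c i *: q i) + \sum_i d i *: q i = \sum_i (k * c i + d i) *: q i.
Proof.
by rewrite scaler_sumr -big_split; apply: eq_bigr => i _; rewrite scalerDl scalerA.
Qed.

Lemma span1 : 1 = \sum_i (1 : R[i]) *: q i.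
Proof. by have [_ _ <-] := parq; apply: eq_bigr => i _; rewrite scale1r. Qed.

(** Closedness reduces to lines: if [u] tends to [l] then [u n * q j], a multiple of [q j], tends to
    [l * q j], which is therefore a multiple of [q j] too. Summing over [j] gives [l]. *)
Lemma partition_span_subalgebra : unital_cstar_subalgebra partition_span.
Proof.
split.
- by exists (fun=> 1); apply: span1.
- by move=> k _ _ [c ->] [d ->]; rewrite span_linear; eexists.
- by move=> _ _ [c ->] [d ->]; rewrite spanM; eexists.
- by move=> _ [c ->]; rewrite span_star; eexists.
move=> u l /choice[c uE] ul.
have /choice[k lE] j : exists k, l * q j = k *: q j.
  apply: (@line_closed _ _ (c^~ j)) => e e0.
  have [N HN] := tendsM ul (tends_cst (q j)) e0.
  by exists N => n /HN; rewrite uE span_mulr.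
exists k; have [_ _ q1] := parq; rewrite -[l]mulr1 -q1 mulr_sumr.
by apply: eq_bigr => j _; rewrite lE.
Qed.

End PartitionSpan.

Section PartitionSection.
Variables (R : realType) (B M : cstarAlgebra R) (pi : B -> M).
Variables (J : finType) (q : J -> M) (Q : J -> B).
Hypotheses (pi_hom : unital_star_hom pi) (parq : projection_partition q)
  (parQ : projection_partition Q) (piQ : forall j, pi (Q j) = q j)
  (Q0 : forall j, q j = 0 -> Q j = 0).

(** Coefficients may be chosen arbitrarily for each element: they are unique where [q j] is nonzero,
    and elsewhere [Q j = 0] hides the choice. *)
Lemma partition_section : exists2 g, unital_cross_section pi (partition_span q) g &
  forall c, g (\sum_j c j *: q j) = \sum_j c j *: Q j.
Proof.
have /choice[cf cfE] x : exists c, partition_span q x -> x = \sum_j c j *: q j.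
  have [[c ->]|nx] := pselect (partition_span q x); first by exists c.
  (* A default outside the span, where values are irrelevant. *)
  by exists (fun=> 0).
pose g x := \sum_j cf x j *: Q j.
have gE c : g (\sum_j c j *: q j) = \sum_j c j *: Q j.
  apply: eq_bigr => j _; set x := \sum_j _; have xE : x = _ := cfE x (ex_intro _ c erefl).
  have : cf x j *: q j = c j *: q j by rewrite -!(span_mulr parq) -xE.
  move/eqP; rewrite -subr_eq0 -scalerBl scaler_eq0 subr_eq0 => /orP[/eqP -> //|/eqP qj0].
  by rewrite Q0 // !scaler0.
have pi_on := unital_star_hom_on pi_hom.
have SB := cstar_star_subalgebra (unital_cstar_subalgebraT B).
exists g => //; split.
- by move=> k _ _ [c ->] [d ->]; rewrite span_linear !gE span_linear.
- by move=> _ _ [c ->] [d ->]; rewrite (spanM parq) !gE (spanM parQ).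
- by move=> _ [c ->]; rewrite (span_star parq) !gE (span_star parQ).
- move=> _ [c ->]; rewrite gE (hom_on_sum SB pi_on) //.
  by apply: eq_bigr => j _; rewrite (hom_onZ SB pi_on) // piQ.
- by rewrite (span1 parq) gE -(span1 parQ).
Qed.

End PartitionSection.

Lemma partition_unit (R : realType) (A : cstarAlgebra R) :
  projection_partition (fun _ : unit => 1 : A).
Proof.
split=> [_||]; first exact: projection1.
- by case=> [] [].
- by rewrite sumr_const card_unit.
Qed.

Section Refinement.
Variables (R : realType) (A : cstarAlgebra R) (J : finType).
Implicit Types (q t : J -> A).

(** Each [q j] splits into [t j], tagged [true], and its complement in [q j]. The family [t] is left
    free so that in [B] its members can be prescribed one by one. *)
Definition refine q t (k : J * bool) : A := if k.2 then t k.1 else q k.1 - t k.1.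

(** Coefficients that ignore the tag give back the coarse combination. This embeds the old span into
    the refined one and makes the new section extend the old one. *)
Lemma sum_refine (c : J -> R[i]) q t :
  \sum_k c k.1 *: refine q t k = \sum_j c j *: q j.
Proof.
rewrite -(pair_bigA _ (fun j b => c j *: refine q t (j, b))) /=.
by apply: eq_bigr => j _; rewrite big_bool /= -scalerDr /refine /= addrC subrK.
Qed.

Lemma refine_partition q t : projection_partition q -> (forall j, projection (t j)) ->
  (forall j, q j * t j = t j) -> (forall j, t j * q j = t j) ->
  projection_partition (refine q t).
Proof.
move=> [pq q0 q1] pt qt tq.
have qr k : q k.1 * refine q t k = refine q t k.
  by case: k => j [] /=; rewrite /refine /= ?mulrBr qt //; case: (pq j) => _ ->.
have rq k : refine q t k * q k.1 = refine q t k.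
  by case: k => j [] /=; rewrite /refine /= ?mulrBl tq //; case: (pq j) => _ ->.
split.
- move=> [j []]; rewrite /refine //=; have [sq qq] := pq j; have [st tt] := pt j.
  split; first by rewrite cs_starB sq st.
  by rewrite mulrBr !mulrBl qq tt qt tq subrr subr0.
- move=> k k' kk'; have [e|ne] := eqVneq k.1 k'.1; last first.
    by rewrite -rq -(qr k') mulrA -[_ * q _ * q _]mulrA q0 // mulr0 mul0r.
  case: k k' kk' e => [j b] [j' b'] /= + e; rewrite -e /refine /= => {e j'} kk'.
  have [_ tt] := pt j.
  by case: b b' kk' => [] [] //=; rewrite ?eqxx // ?mulrBr ?mulrBl ?qt ?tq tt subrr.
- rewrite -q1 (eq_bigr (fun k => (1 : R[i]) *: refine q t k)) => [|k _]; last by rewrite scale1r.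
  by rewrite (sum_refine (fun=> 1)); apply: eq_bigr => j _; rewrite scale1r.
Qed.

End Refinement.

(** * Adjoining one projection *)

Section Step.
Variables (R : realType) (B M : cstarAlgebra R) (pi : B -> M).
Hypotheses (rr : real_rank_zero B) (pi_hom : unital_star_hom pi)
  (pi_surj : forall m, exists b, pi b = m).

Lemma refine_proj_partition (J : finType) (q : J -> M) p :
  projection_partition q -> projection p -> (forall j, p * q j = q j * p) ->
  projection_partition (refine q (fun j => q j * p)).
Proof.
move=> parq pp pq; have [proj_q _ _] := parq; have [sp p2] := pp.
apply: refine_partition => // j; have [sq qq] := proj_q j.
- split; first by rewrite cs_starM sq sp pq.
  by rewrite mulrA -[q j * p * q j]mulrA pq mulrA qq -mulrA p2.
- by rewrite mulrA qq.
- by rewrite -mulrA pq mulrA qq.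
Qed.

(* Where [q j * p] is [0] or [q j] the lift must be [0] or [Q j], since relations
   such as [q j * p = 0] have to be preserved by the cross section. *)
Lemma lift_refinement (J : finType) (q : J -> M) (Q : J -> B) (p : M) :
  projection_partition q -> projection_partition Q ->
  (forall j, pi (Q j) = q j) -> (forall j, q j = 0 -> Q j = 0) ->
  projection p -> (forall j, p * q j = q j * p) ->
  exists t, [/\ projection_partition (refine Q t),
    forall k, pi (refine Q t k) = refine q (fun j => q j * p) k &
    forall k, refine q (fun j => q j * p) k = 0 -> refine Q t k = 0].
Proof.
move=> parq parQ piQ Q0 pp pq.
have pi_on := unital_star_hom_on pi_hom.
have SB := cstar_star_subalgebra (unital_cstar_subalgebraT B).
have pQ j : p * pi (Q j) = pi (Q j) * p by rewrite piQ.
have [P [[sP PP] piP PQ]] := lift_projection rr pi_hom pi_surj parQ pp pQ.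
have [projQ _ _] := parQ.
have /choice[t Ht] j : exists t, [/\ projection t, Q j * t = t /\ t * Q j = t,
    pi t = q j * p, q j * p = 0 -> t = 0 & q j * p = q j -> t = Q j].
  have [sQ QQ] := projQ j.
  have [z|nz] := eqVneq (q j * p) 0.
    exists 0; rewrite z (hom_on0 SB pi_on) mulr0 mul0r.
    split=> //; first by split; rewrite ?cs_star0 ?mulr0.
    by move=> e; rewrite Q0.
  have [e|ne] := eqVneq (q j * p) (q j).
    exists (Q j); rewrite e piQ QQ; split=> //; first exact: Q0.
  exists (Q j * P); split.
  - split; first by rewrite cs_starM sQ sP PQ.
    by rewrite mulrA -[Q j * P * Q j]mulrA PQ mulrA QQ -mulrA PP.
  - by rewrite mulrA QQ -mulrA PQ mulrA QQ.
  - by rewrite (hom_onM pi_on) // piQ piP.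
  - by move=> z; rewrite z eqxx in nz.
  - by move=> e; rewrite e eqxx in ne.
exists t; split.
- by apply: refine_partition => // j; case: (Ht j) => ? [].
- by case=> j []; rewrite /refine /= ?(hom_onB SB pi_on) // ?piQ; case: (Ht j) => _ _ ->.
- case=> j []; rewrite /refine /=; case: (Ht j) => _ _ _ t0 tQ; first exact: t0.
  by move/eqP; rewrite subr_eq0 eq_sym => /eqP/tQ ->; rewrite subrr.
Qed.

Variables (p : nat -> M).
Hypotheses (proj_p : forall i, projection (p i)) (comm_p : forall i j, p i * p j = p j * p i).

Definition genp n := cstar_gen (fun x => exists2 i, (i < n)%N & x = p i).

Lemma genp_subalgebra n : unital_star_subalgebra (genp n).
Proof. exact/cstar_star_subalgebra/cstar_gen_subalgebra. Qed.

(** The commutant of the self-adjoint element [p i] is a C*-subalgebra containing every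
    generator. *)
Lemma genp_comm n i x : genp n x -> p i * x = x * p i.
Proof.
move=> gx; apply: (gx (fun x => p i * x = x * p i)); last by move=> _ [j _ ->]; rewrite comm_p.
have [sp _] := proj_p i; split.
- by rewrite mulr1 mul1r.
- by move=> c a b pa pb; rewrite mulrDr mulrDl -scalerAr -scalerAl pa pb.
- by move=> a b pa pb; rewrite mulrA pa -mulrA pb mulrA.
- by move=> a pa; rewrite -{1}sp -cs_starM -pa cs_starM sp.
- by move=> u l pu ul; apply: (tends_intertwine ul ul).
Qed.

(** By minimality it suffices that the refined span, a C*-subalgebra, contains the generators:
    earlier ones lie in the coarse span, and [p n] is the sum of the [q j * p n]. *)
Lemma genp_span n (J : finType) (q : J -> M) :
  projection_partition q -> (forall j, p n * q j = q j * p n) ->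
  (forall x, genp n x -> partition_span q x) ->
  forall x, genp n.+1 x -> partition_span (refine q (fun j => q j * p n)) x.
Proof.
move=> parq pq spq x gx; have parr := refine_proj_partition parq (proj_p n) pq.
apply: (gx _ (partition_span_subalgebra parr)) => y [i ltin ->].
have [lt|ge] := ltnP i n.
  have [|c ->] := spq (p i); first by apply: cstar_gen_incl; exists i.
  by exists (fun k => c k.1); rewrite sum_refine.
have -> : i = n by apply/eqP; rewrite eqn_leq ge -ltnS ltin.
(* These coefficients select the pieces below [p n]. *)
exists (fun k => if k.2 then 1 else 0); have [_ _ q1] := parq.
rewrite -(pair_bigA _ (fun j b => (if b then 1 else 0 : R[i]) *: refine q _ (j, b))) /=.
rewrite -[LHS]mul1r -q1 mulr_suml; apply: eq_bigr => j _.
by rewrite big_bool /= scale1r scale0r addr0.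
Qed.

(** Induction from the partition with the single member 1, refining by [p n] at each stage.
    Membership of [q j] in [genp n] makes it commute with [p n] and lets a cross section act on
    it. *)
Lemma genp_partition n : exists (J : finType) (q : J -> M),
  [/\ projection_partition q, forall j, genp n (q j) &
    forall x, genp n x -> partition_span q x].
Proof.
elim: n => [|n [J [q [parq gq spq]]]].
  exists unit, (fun=> 1).
  have par := partition_unit M.
  split=> //; first by move=> _ S [].
  by move=> x gx; apply: (gx _ (partition_span_subalgebra par)) => y [].
have pq j : p n * q j = q j * p n by apply: genp_comm (gq j).
have parr := refine_proj_partition parq (proj_p n) pq.
have SM := genp_subalgebra n.+1.
have gq' j : genp n.+1 (q j).
  by apply: cstar_gen_mono (gq j) => y [i ltin ->]; exists i => //; apply: leqW.
have gp : genp n.+1 (p n) by apply: cstar_gen_incl; exists n.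
exists (J * bool)%type, (refine q (fun j => q j * p n)); split=> //.
  case=> j []; rewrite /refine /=; first exact: (subalgM SM (gq' j) gp).
  exact: (subalgB SM (gq' j) (subalgM SM (gq' j) gp)).
exact: genp_span.
Qed.

Lemma section_extension n gn : unital_cross_section pi (genp n) gn ->
  exists2 gn1, unital_cross_section pi (genp n.+1) gn1 &
    forall x, genp n x -> gn1 x = gn x.
Proof.
move=> sec; have [J [q [parq gq spq]]] := genp_partition n.
have hom := cross_section_hom_on sec.
have SM := genp_subalgebra n.
pose Q j := gn (q j).
have parQ : projection_partition Q.
  have [proj_q q0 q1] := parq; split.
  - by move=> j; have [sq qq] := proj_q j; split; rewrite -?(hom_on_star hom) -?(hom_onM hom) ?sq ?qq.
  - by move=> i j ij; rewrite -(hom_onM hom) ?q0 // (hom_on0 SM hom).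
  - by rewrite -(hom_on_sum SM hom) // q1 (hom_on1 hom).
have piQ j : pi (Q j) = q j by case: sec => _ _ _ + _; apply.
have Q0 j : q j = 0 -> Q j = 0 by rewrite /Q => ->; apply: hom_on0 SM hom.
have pq j : p n * q j = q j * p n by apply: genp_comm (gq j).
have [t [parr pir r0]] := lift_refinement parq parQ piQ Q0 (proj_p n) pq.
have parq' := refine_proj_partition parq (proj_p n) pq.
have [g secg gE] := partition_section pi_hom parq' parr pir r0.
exists g.
  by apply: unital_cross_section_sub secg; apply: genp_span.
move=> x /spq[c ->].
(* On an element of the coarse span the tag-independent coefficients collapse in [M] and in [B]
   alike, leaving the combination of the [gn (q j)]. *)
rewrite -(sum_refine c q (fun j => q j * p n)) gE !sum_refine (hom_on_sum SM hom).
  by apply: eq_bigr => j _; rewrite (hom_onZ SM hom).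
by move=> j; apply: (subalgZ SM).
Qed.

End Step.

(** * Countably many projections *)

Section ClosureExtension.
Variables (R : realType) (A : cstarAlgebra R) (U : A -> Prop).
Hypothesis SU : unital_star_subalgebra U.

Definition seq_closure x := exists2 u : nat -> A, forall n, U (u n) & tends u x.

Lemma seq_closure_incl x : U x -> seq_closure x.
Proof. by exists (fun=> x) => //; apply: tends_cst. Qed.

Lemma seq_closure_approx x e : seq_closure x -> 0 < e -> exists2 y, U y & cs_norm (y - x) < e.
Proof. by move=> [u Uu ux] /ux[N /(_ _ (leqnn N)) H]; exists (u N). Qed.

Lemma approx_seq_closure x :
  (forall e, 0 < e -> exists2 y, U y & cs_norm (y - x) < e) -> seq_closure x.
Proof.
move=> H; have /choice[u Hu] n : exists y, U y /\ cs_norm (y - x) < n.+1%:R^-1.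
  by have [|y Uy yx] := H (n.+1%:R^-1); [rewrite invr_gt0 | exists y].
exists u => [n|e e0]; first by case: (Hu n).
exists (Num.bound e^-1) => n Nn; have [_ /lt_trans] := Hu n; apply.
rewrite invf_plt ?posrE //; apply: lt_le_trans (archi_boundP _) _.
  by rewrite invr_ge0 ltW.
by rewrite ler_nat leqW.
Qed.

Lemma seq_closure_subalgebra : unital_cstar_subalgebra seq_closure.
Proof.
split.
- exact/seq_closure_incl/(subalg1 SU).
- move=> c a b [u Uu ua] [v Uv vb]; exists (fun n => c *: u n + v n).
    by move=> n; apply: (subalgD SU) => //; apply: (subalgZ SU).
  exact: tendsD (tendsZ c ua) vb.
- move=> a b [u Uu ua] [v Uv vb]; exists (fun n => u n * v n); last exact: tendsM.
  by move=> n; apply: (subalgM SU).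
- move=> a [u Uu ua]; exists (fun n => cs_star (u n)); last exact: tends_star.
  by move=> n; apply: (subalg_star SU).
- move=> u l Uu ul; apply: approx_seq_closure => e e0.
  have e2 : 0 < e / 2 by lra.
  have [N /(_ _ (leqnn N)) h1] := ul _ e2.
  have [y Uy h2] := seq_closure_approx (Uu N) e2; exists y => //.
  rewrite -[y](subrK (u N)) -addrA; apply: le_lt_trans (cs_normD _ _) _.
  clear - h1 h2; lra.
Qed.

(** Contractivity makes the images of a convergent sequence Cauchy, with a limit independent of the
    sequence; the algebraic identities pass to limits. It is a hypothesis here because [U] may fail
    to be closed. *)
Lemma hom_on_closure (B : cstarAlgebra R) (f : A -> B) :
  star_hom_on U f -> (forall x, U x -> cs_norm (f x) <= cs_norm x) ->
  exists2 g, star_hom_on seq_closure g &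
    forall u x, (forall n, U (u n)) -> tends u x -> tends (fun n => f (u n)) (g x).
Proof.
move=> Hf fle.
have fB x y : U x -> U y -> cs_norm (f x - f y) <= cs_norm (x - y).
  by move=> Ux Uy; rewrite -(hom_onB SU Hf) // fle //; apply: (subalgB SU).
have /choice[g gE] x : exists z, forall u, (forall n, U (u n)) -> tends u x ->
    tends (fun n => f (u n)) z.
  have [[u Uu ux]|nx] := pselect (seq_closure x); last first.
    by exists 0 => u Uu ux; case: nx; exists u.
  have [z uz] : exists z, tends (fun n => f (u n)) z.
    apply: (nrm_complete (cs_ax B)) => e e0; have e2 : 0 < e / 2 by lra.
    have [N HN] := ux _ e2; exists N => m n /HN h1 /HN h2.
    apply: le_lt_trans (fB _ _ (Uu m) (Uu n)) _.
    rewrite -[u m](subrK x) -addrA; apply: le_lt_trans (cs_normD _ _) _.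
    rewrite (cs_distC x); clear - h1 h2; lra.
  exists z => v Uv vx e e0; have e3 : 0 < e / 3 by lra.
  have [N1 H1] := ux _ e3; have [N2 H2] := vx _ e3; have [N3 H3] := uz _ e3.
  exists (maxn N1 (maxn N2 N3)) => n; rewrite !geq_max => /and3P[/H1 h1 /H2 h2 /H3 h3].
  have h4 := fB _ _ (Uv n) (Uu n).
  have h5 : cs_norm (v n - u n) <= cs_norm (v n - x) + cs_norm (u n - x).
    by rewrite -[v n](subrK x) -addrA (cs_distC (u n)) addrK; apply: cs_normD.
  rewrite -[f (v n)](subrK (f (u n))) -addrA; apply: le_lt_trans (cs_normD _ _) _.
  clear - h1 h2 h3 h4 h5; lra.
exists g; last by move=> u x; apply: gE.
split.
- move=> c a b [u Uu ua] [v Uv vb].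
  have Uw n : U (c *: u n + v n) by apply: (subalgD SU) => //; apply: (subalgZ SU).
  apply: tends_unique (gE _ _ Uw (tendsD (tendsZ c ua) vb)) _ => e e0.
  have [N HN] := tendsD (tendsZ c (gE _ _ Uu ua)) (gE _ _ Uv vb) e0.
  by exists N => n /HN; case: Hf => fD _ _ _; rewrite fD.
- move=> a b [u Uu ua] [v Uv vb].
  have Uw n : U (u n * v n) by apply: (subalgM SU).
  apply: tends_unique (gE _ _ Uw (tendsM ua vb)) _ => e e0.
  have [N HN] := tendsM (gE _ _ Uu ua) (gE _ _ Uv vb) e0.
  by exists N => n /HN; rewrite (hom_onM Hf).
- move=> a [u Uu ua].
  have Uw n : U (cs_star (u n)) by apply: (subalg_star SU).
  apply: tends_unique (gE _ _ Uw (tends_star ua)) _ => e e0.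
  have [N HN] := tends_star (gE _ _ Uu ua) e0.
  by exists N => n /HN; rewrite (hom_on_star Hf).
- have := gE 1 (fun=> 1) (fun=> subalg1 SU) (tends_cst 1).
  by rewrite /= (hom_on1 Hf) => g1; apply: tends_unique g1 (tends_cst 1).
Qed.

End ClosureExtension.

Section Union.
Variables (R : realType) (B M : cstarAlgebra R) (pi : B -> M).
Hypotheses (rr : real_rank_zero B) (pi_hom : unital_star_hom pi)
  (pi_surj : forall m, exists b, pi b = m).
Variables (p : nat -> M).
Hypotheses (proj_p : forall i, projection (p i)) (comm_p : forall i j, p i * p j = p j * p i).

Lemma genp_mono m n x : (m <= n)%N -> genp p m x -> genp p n x.
Proof.
by move=> mn; apply: cstar_gen_mono => y [i im ->]; exists i => //; apply: leq_trans mn.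
Qed.

Lemma section_genp0 : exists g, unital_cross_section pi (genp p 0) g.
Proof.
have [g secg _] : exists2 g, unital_cross_section pi (partition_span (fun _ : unit => 1)) g &
    forall c, g (\sum_(j : unit) c j *: 1) = \sum_j c j *: 1.
  apply: partition_section => //; try exact: partition_unit.
    by case: pi_hom.
  (* The single member is 1, which is nonzero in [M], so the condition on zero members is
     vacuous. *)
  by move=> _ /eqP; rewrite oner_eq0.
exists g; apply: unital_cross_section_sub secg => x gx.
by apply: (gx _ (partition_span_subalgebra (partition_unit M))) => y [].
Qed.

Lemma section_chain : exists G : nat -> M -> B,
  (forall n, unital_cross_section pi (genp p n) (G n)) /\
  (forall m n x, (m <= n)%N -> genp p m x -> G n x = G m x).
Proof.
have [g0 sec0] := section_genp0.
(* The extension step is made a total function of a stage and a candidate, so that it can be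
   iterated; a candidate that is no cross section is returned unchanged. *)
have /choice[next Hnext] (ng : nat * (M -> B)) : exists g,
    unital_cross_section pi (genp p ng.1) ng.2 ->
    unital_cross_section pi (genp p ng.1.+1) g /\ forall x, genp p ng.1 x -> g x = ng.2 x.
  have [sec|nsec] := pselect (unital_cross_section pi (genp p ng.1) ng.2); last first.
    by exists ng.2.
  have [g secg gE] := section_extension rr pi_hom pi_surj proj_p comm_p sec.
  by exists g.
pose G := fix G n := if n is m.+1 then next (m, G m) else g0.
have secG n : unital_cross_section pi (genp p n) (G n).
  by elim: n => [//|n IH]; case: (Hnext (n, G n) IH).
exists G; split=> // m n x + gx; elim: n => [|n IH]; first by rewrite leqn0 => /eqP ->.
rewrite leq_eqVlt => /orP[/eqP -> //|mn]; rewrite -IH //.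
by have [_ H] := Hnext (n, G n) (secG n); apply: H; apply: genp_mono gx; rewrite -ltnS.
Qed.

(** The compatible sections glue to [f] on the union [U] of the stages. Each stage is closed, so [f]
    is contractive there and hence on [U], and it extends to the closure, which contains the
    generated algebra. *)
Lemma section_all :
  exists g, unital_cross_section pi (cstar_gen (fun x => exists i, x = p i)) g.
Proof.
have [G [secG GE]] := section_chain.
pose U x := exists n, genp p n x.
have U2 x y : U x -> U y -> exists n, genp p n x /\ genp p n y.
  move=> [m mx] [n ny]; exists (maxn m n).
  by split; [apply: genp_mono mx; rewrite leq_maxl | apply: genp_mono ny; rewrite leq_maxr].
have SU : unital_star_subalgebra U.
  split.
  - by exists 0%N; apply: subalg1 (genp_subalgebra _ _).
  - move=> c x y Ux Uy; have [n [nx ny]] := U2 _ _ Ux Uy; exists n.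
    by have SG := genp_subalgebra p n; apply: (subalgD SG) => //; apply: (subalgZ SG).
  - move=> x y Ux Uy; have [n [nx ny]] := U2 _ _ Ux Uy; exists n.
    exact: (subalgM (genp_subalgebra p n) nx ny).
  - by move=> x [n nx]; exists n; apply: (subalg_star (genp_subalgebra p n) nx).
have /choice[f fE] x : exists z, forall n, genp p n x -> z = G n x.
  have [[m mx]|nx] := pselect (U x); last by exists 0 => n nx'; case: nx; exists n.
  exists (G m x) => n nx; have [mn|/ltnW nm] := leqP m n; first by rewrite (GE m n).
  exact: GE.
have fhom : star_hom_on U f.
  split.
  - move=> c x y Ux Uy; have [n [nx ny]] := U2 _ _ Ux Uy.
    have SG := genp_subalgebra p n.
    rewrite (fE _ n nx) (fE _ n ny) (fE _ n); first by case: (secG n) => + _ _ _ _; apply.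
    by apply: (subalgD SG) => //; apply: (subalgZ SG).
  - move=> x y Ux Uy; have [n [nx ny]] := U2 _ _ Ux Uy.
    rewrite (fE _ n nx) (fE _ n ny) (fE _ n); first by case: (secG n) => _ + _ _ _; apply.
    exact: (subalgM (genp_subalgebra p n) nx ny).
  - move=> x [n nx]; rewrite (fE _ n nx) (fE _ n); first by case: (secG n) => _ _ + _ _; apply.
    exact: (subalg_star (genp_subalgebra p n) nx).
  - rewrite (fE _ 0%N); first by case: (secG 0%N).
    exact: subalg1 (genp_subalgebra _ _).
have fle x : U x -> cs_norm (f x) <= cs_norm x.
  move=> [n nx]; rewrite (fE _ n nx).
  exact: hom_on_contractive (cstar_gen_subalgebra _) (cross_section_hom_on (secG n)) nx.
have [g ghom gE] := hom_on_closure SU fhom fle.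
exists g; apply: (@unital_cross_section_sub _ _ _ _ _ (seq_closure U)).
  move=> x gx; apply: (gx _ (seq_closure_subalgebra SU)) => _ [i ->].
  (* Stages use indices strictly below their number, so [p i] first appears at stage [i.+1]. *)
  by apply: seq_closure_incl; exists i.+1; apply: cstar_gen_incl; exists i.
have [gD gM gs g1] := ghom; split=> // x [u Uu ux].
(* By continuity of [pi], the sequence [pi (f (u n))] tends to [pi (g x)]; it equals [u n], which
   tends to [x]. *)
have pif := hom_on_tends (unital_cstar_subalgebraT _) (unital_star_hom_on pi_hom) (fun=> I)
  (gE _ _ Uu ux).
apply: tends_unique pif _ => e /ux[N HN]; exists N => n /HN.
by have [m mu] := Uu n; rewrite (fE _ m mu); have [_ _ _ -> //] := secG m.
Qed.

End Union.

Unset Implicit Arguments.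

Theorem theorem4p3 (R : realType) (B M : cstarAlgebra R) (pi : B -> M) :
  real_rank_zero B ->
  unital_star_hom pi ->
  (forall m : M, exists b : B, pi b = m) ->
  forall p : nat -> M,
    (forall i, projection (p i)) ->
    (forall i j, p i * p j = p j * p i) ->
    (exists g : M -> B,
        unital_cross_section pi (cstar_gen (fun x => exists i, x = p i)) g)
    /\
    (forall (n : nat) (gn : M -> B),
        unital_cross_section pi
          (cstar_gen (fun x => exists2 i, (i < n)%N & x = p i)) gn ->
        exists gn1 : M -> B,
          unital_cross_section pi
            (cstar_gen (fun x => exists2 i, (i < n.+1)%N & x = p i)) gn1
          /\ forall x, cstar_gen (fun x => exists2 i, (i < n)%N & x = p i) x ->
               gn1 x = gn x).
Proof.
move=> rr pi_hom pi_surj p proj_p comm_p; split; first exact: section_all.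
move=> n gn sec; have [gn1 sec1 ext] := section_extension rr pi_hom pi_surj proj_p comm_p sec.
by exists gn1.
Qed.
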